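(* Let $\mathbf d\in(\mathbb Z_{\ge0})^k$. The action of $E,F,K^{\pm1}$ on functions on the tensor product variety $\mathfrak T(\mathbf d)$ endows $\mathcal T(\mathbf d)$, the space of $GL(D)$-invariant functions on $\mathfrak T(\mathbf d)$, with the structure of a $\mathbf U_q$-module, and, for $\mathbf r,\mathbf n\in(\mathbb Z_{\ge0})^k$, the map $$\eta_{\mathbf r,\mathbf n}:\operatorname{Span}\{f_{\mathbf w,\mathbf r,\mathbf n}\}_{\mathbf w}\to V_{\mathbf n_1-\mathbf r_1}\otimes\cdots\otimes V_{\mathbf n_k-\mathbf r_k}$$ given by $$\eta_{\mathbf r,\mathbf n}(f_{\mathbf w,\mathbf r,\mathbf n})=\otimes\,{}^{\mathbf n-\mathbf r}v_{\mathbf w-\mathbf r}$$ (and extended by linearity) is a $\mathbf U_q$-module isomorphism.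
   Context: **Conventions.** Vector spaces are over the finite field $\mathbb F_{q^2}$ with $q^2$ elements, and varieties are identified with their finite sets of $\mathbb F_{q^2}$-points. Functions on varieties take values in $\mathbb C(q)$, the field of rational functions in an indeterminate $q$; numbers of points are expressed in terms of $q$ and regarded as elements of $\mathbb C(q)$. Spans are $\mathbb C(q)$-spans. $\mathbf 1_Y$ is the function equal to $1$ on $Y$ and $0$ elsewhere. **Quantum group.** $\mathbf U_q=U_q(\mathfrak{sl}_2)$ is the associative $\mathbb C(q)$-algebra generated by $E,F,K,K^{-1}$ with $KK^{-1}=K^{-1}K=1$, $KE=q^2EK$, $KF=q^{-2}FK$, $EF-FE=(K-K^{-1})/(q-q^{-1})$, with comultiplication $\Delta K^{\pm1}=K^{\pm1}\otimes K^{\pm1}$, $\Delta E=E\otimes1+K\otimes E$, $\Delta F=F\otimes K^{-1}+1\otimes F$; tensor products of modules are modules via the iterated comultiplication. Put $[n]=(q^n-q^{-n})/(q-q^{-1})$. $V_e$ is the irreducible module with basis $v_e,v_{e-2},\dots,v_{-e}$ and action $K^{\pm1}v_m=q^{\pm m}v_m$, $Ev_m=[\frac{e+m}2+1]v_{m+2}$, $Fv_m=[\frac{e-m}2+1]v_{m-2}$, where $v_m=0$ for $m$ outside this list. For $k$-tuples $\mathbf e,\mathbf u$, write $\otimes\,{}^{\mathbf e}v_{\mathbf u}=v_{\mathbf e_1-2\mathbf u_1}\otimes\cdots\otimes v_{\mathbf e_k-2\mathbf u_k}\in V_{\mathbf e_1}\otimes\cdots\otimes V_{\mathbf e_k}$.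 **Tensor product variety.** Let $d=\sum_i\mathbf d_i$ and let $D$ be a fixed $d$-dimensional vector space. $\mathfrak T(\mathbf d)$ is the set of triples $(\mathbf D,W,t)$, where $\mathbf D=(0=\mathbf D_0\subset\mathbf D_1\subset\cdots\subset\mathbf D_k=D)$ is a flag with $\dim\mathbf D_i/\mathbf D_{i-1}=\mathbf d_i$, $W\subset D$ is a subspace, and $t\in\operatorname{End}D$ satisfies $t(\mathbf D_i)\subset\mathbf D_{i-1}$ and $\operatorname{im}t\subset W\subset\ker t$. The group $GL(D)$ acts by $g\cdot(\mathbf D,W,t)=(g\mathbf D,gW,gtg^{-1})$. A function $f$ on $\mathfrak T(\mathbf d)$ is invariant if $f(g^{-1}x)=f(x)$ for all $g\in GL(D)$ and $x\in\mathfrak T(\mathbf d)$; $\mathcal T(\mathbf d)$ denotes the space of invariant functions on $\mathfrak T(\mathbf d)$. **Action.** For a function $f$ on $\mathfrak T(\mathbf d)$: $(Ef)(\mathbf D,W,t)=q^{-\dim P_1}\sum_{U\in P_1}f(\mathbf D,U,t)$, where $P_1=\{U: W\subset U\subset\ker t,\ \dim U=\dim W+1\}$, a projective space of dimension $\dim\ker t-\dim W-1$; $(Ff)(\mathbf D,W,t)=q^{-\dim P_2}\sum_{U\in P_2}f(\mathbf D,U,t)$, where $P_2=\{U:\operatorname{im}t\subset U\subset W,\ \dim U=\dim W-1\}$, a projective space of dimension $\dim W-\operatorname{rank}t-1$; $(K^{\pm1}f)(\mathbf D,W,t)=q^{\pm(d-2\dim W)}f(\mathbf D,W,t)$. (An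 empty sum is $0$.) **Basic functions.** For a subspace $X\subset D$ and a flag $\mathbf D$, $\alpha(X,\mathbf D)\in(\mathbb Z_{\ge0})^k$ is given by $\alpha(X,\mathbf D)_i=\dim\,(X\cap\mathbf D_i)/(X\cap\mathbf D_{i-1})$. For $\mathbf w,\mathbf r,\mathbf n\in(\mathbb Z_{\ge0})^k$, $$A_{\mathbf w,\mathbf r,\mathbf n}=\{(\mathbf D,W,t)\in\mathfrak T(\mathbf d):\alpha(W,\mathbf D)=\mathbf w,\ \alpha(\operatorname{im}t,\mathbf D)=\mathbf r,\ \alpha(\ker t,\mathbf D)=\mathbf n\},$$ $$f_{\mathbf w,\mathbf r,\mathbf n}=q^{\sum_{i<j}(\mathbf r_i\mathbf w_j+\mathbf w_i\mathbf n_j-\mathbf w_i\mathbf w_j)}\,\mathbf 1_{A_{\mathbf w,\mathbf r,\mathbf n}}.$$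
   Formalization: The claim about η_{r,n} is stated for r,n such that some A_{w,r,n} is nonempty; otherwise all f_{w,r,n} vanish, so the span is 0 while the tensor product is nonzero or undefined (e.g. k=1, d=2, r=0, n=1). *)

(* Defs.v *)
From HB Require Import structures.
From mathcomp Require Import all_boot all_order all_algebra.
From mathcomp Require Import boolp reals complex.

Set Implicit Arguments.
Unset Strict Implicit.
Unset Printing Implicit Defensive.

Import GRing.Theory VectorInternalTheory.

Local Open Scope ring_scope.

(* Over a finite field the subspaces and the endomorphisms of a finite
   dimensional space form finite types. *)
HB.instance Definition _ (F : finFieldType) (D : vectType F) :=
  [Countable of {vspace D} by <:].
HB.instance Definition _ (F : finFieldType) (D : vectType F) :=
  [Finite of {vspace D} by <:].
HB.instance Definition _ (F : finFieldType) (D : vectType F) :=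
  [Countable of 'End(D) by <:].
HB.instance Definition _ (F : finFieldType) (D : vectType F) :=
  [Finite of 'End(D) by <:].

(* The field of rational functions in one indeterminate over the complex
   numbers [R[i]]. *)
Notation Cq R := {fraction {poly R[i]}}.

Section QuantumGroup.

Variable R : realType.

Definition q : Cq R := tofrac 'X.

Definition qint (n : int) : Cq R := (q ^ n - q ^ (- n)) / (q - q^-1).

(* Only the generators (and the unit) are represented: modules over the algebra
   presented by these generators are vector spaces on which the generators act
   linearly so that the defining relations hold. *)
Inductive Ugen := U1 | UE | UF | UK | UKi.

(* [S] is a subspace of [V] which is a module under the operators [act]; nothing
   is required of [act] outside [S]. *)
Record Uq_module (V : lmodType (Cq R)) (S : {pred V}) (act : Ugen -> V -> V) :
    Prop := UqModule {
  Uq_subspace : submod_closed S;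
  Uq_stable : forall g, {in S, forall x, act g x \in S};
  Uq_linear : forall g (a : Cq R), {in S &, forall x y,
    act g (a *: x + y) = a *: act g x + act g y};
  Uq_1 : {in S, forall x, act U1 x = x};
  Uq_KKi : {in S, forall x, act UK (act UKi x) = x};
  Uq_KiK : {in S, forall x, act UKi (act UK x) = x};
  Uq_KE : {in S, forall x, act UK (act UE x) = q ^+ 2 *: act UE (act UK x)};
  Uq_KF : {in S, forall x, act UK (act UF x) = q ^- 2 *: act UF (act UK x)};
  Uq_EF : {in S, forall x, act UE (act UF x) - act UF (act UE x) =
    (q - q^-1)^-1 *: (act UK x - act UKi x)} }.

(* [eta] restricts to an isomorphism of modules from [S] onto [V']. *)
Record Uq_iso (V V' : lmodType (Cq R)) (S : {pred V})
    (act : Ugen -> V -> V) (act' : Ugen -> V' -> V') (eta : V -> V') :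
    Prop := UqIso {
  Uq_iso_linear : forall (a : Cq R), {in S &, forall x y,
    eta (a *: x + y) = a *: eta x + eta y};
  Uq_iso_inj : {in S &, injective eta};
  Uq_iso_surj : forall v, exists2 x, x \in S & eta x = v;
  Uq_iso_act : forall g, {in S, forall x, eta (act g x) = act' g (eta x)} }.

(* [V_e], with the basis vector [v_(e - 2u)] as the indicator function of [u]. *)
Definition Ve (e : nat) := {ffun 'I_e.+1 -> (Cq R)^o}.

(* Zero when [m] is not one of the weights [e, e - 2, ..., - e]. *)
Definition vvec (e : nat) (m : int) : Ve e :=
  [ffun u : 'I_e.+1 => (m == e%:Z - (u : nat)%:Z *+ 2)%:R].

Definition vact_basis (e : nat) (g : Ugen) (m : int) : Ve e :=
  match g with
  | U1 => vvec e m
  | UE => qint (((e%:Z + m) %/ 2)%Z + 1) *: vvec e (m + 2)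
  | UF => qint (((e%:Z - m) %/ 2)%Z + 1) *: vvec e (m - 2)
  | UK => q ^ m *: vvec e m
  | UKi => q ^ (- m) *: vvec e m
  end.

(* The comultiplication of a generator, a sum of tensors of generators. *)
Definition comul (g : Ugen) : seq (Ugen * Ugen) :=
  match g with
  | U1 => [:: (U1, U1)]
  | UE => [:: (UE, U1); (UK, UE)]
  | UF => [:: (UF, UKi); (U1, UF)]
  | UK => [:: (UK, UK)]
  | UKi => [:: (UKi, UKi)]
  end.

(* The iterated comultiplication into the [k]-th tensor power, as a sum of
   [k]-fold tensors of generators. It starts with the counit at [k = 0], so that
   it is the identity at [k = 1] and [comul] at [k = 2]. *)
Fixpoint iter_comul (k : nat) (g : Ugen) : seq (seq Ugen) :=
  match k with
  | 0 => match g with UE | UF => [::] | _ => [:: [::]] end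
  | k'.+1 => flatten [seq [seq ab.1 :: s | s <- iter_comul k' ab.2]
                     | ab <- comul g]
  end.

Section TensorProduct.

Variables (k : nat) (e : 'I_k -> nat).

(* The tensor product of the [V_(e i)], coordinatized by the tensor products of
   basis vectors. *)
Definition Vtens :=
  {ffun {dffun forall i : 'I_k, 'I_(e i).+1} -> (Cq R)^o}.

Definition otimes (x : forall i, Ve (e i)) : Vtens :=
  [ffun p : {dffun forall i : 'I_k, 'I_(e i).+1} => \prod_i x i (p i)].

Definition tens_act (g : Ugen) (x : Vtens) : Vtens :=
  \sum_(s <- iter_comul k g)
    \sum_(p : {dffun forall i : 'I_k, 'I_(e i).+1})
      x p *: otimes (fun i =>
        vact_basis (e i) (nth U1 s i) ((e i)%:Z - (p i : nat)%:Z *+ 2)).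

(* The tensor product of the [v_(e i - 2 u i)]. *)
Definition tens_vec (u : 'I_k -> int) : Vtens :=
  otimes (fun i => vvec (e i) ((e i)%:Z - u i *+ 2)).

End TensorProduct.

(* A number [N] of points over the field with [Q] elements is expressed in terms
   of the indeterminate [q] by replacing [Q] with [q ^+ 2] in the base [Q]
   expansion of [N]. Thus a projective space of dimension [m], with
   [1 + Q + ... + Q ^ m] points, has [1 + q ^+ 2 + ... + q ^+ (2 * m)] points in
   [Cq R]. More generally a disjoint union of Schubert cells of a projective
   space, relative to a fixed flag, has [\sum_(i in I) Q ^ i] points for some set
   [I] of exponents, and [\sum_(i in I) q ^+ (2 * i)] points in [Cq R] (see
   [point_countE]); so the count is additive on such unions. *)
Definition point_count (Q N : nat) : Cq R :=
  \sum_(i < N) ((N %/ Q ^ i) %% Q)%:R * q ^+ (2 * i).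

Lemma expansion_widen (Q N B : nat) : (1 < Q)%N -> (N < Q ^ B)%N ->
  \sum_(i < B) ((N %/ Q ^ i) %% Q)%:R * q ^+ (2 * i) = point_count Q N.
Proof.
move=> Q1; rewrite /point_count.
pose S B := \sum_(0 <= i < B) ((N %/ Q ^ i) %% Q)%:R * q ^+ (2 * i).
have SE m p : (N < Q ^ m)%N -> (m <= p)%N -> S p = S m.
  move=> Nm mp; rewrite /S (@big_cat_nat _ _ _ m) ?leq0n //= [X in _ + X]big_nat_cond.
  rewrite [X in _ + X]big1 ?addr0 // => i /andP[/andP[mi _] _].
  rewrite divn_small ?mod0n ?mul0r // (leq_trans Nm) //.
  by rewrite leq_exp2l.
move=> NB; have NN := ltn_expl N Q1.
rewrite -!(big_mkord xpredT
  (fun i => ((N %/ Q ^ i) %% Q)%:R * q ^+ (2 * i))) -/(S B) -/(S N).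
by case: (leqP B N) => [/SE -> //|/ltnW /SE ->].
Qed.

Lemma digitsP (Q m : nat) (a : nat -> nat) : (forall i, a i < Q)%N ->
  (\sum_(i < m) a i * Q ^ i < Q ^ m)%N /\
  forall i, (i < m)%N -> ((\sum_(j < m) a j * Q ^ j) %/ Q ^ i %% Q)%N = a i.
Proof.
elim: m a => [|m IH] a aQ; first by rewrite big_ord0.
have Q0 : (0 < Q)%N by apply: leq_ltn_trans (aQ 0).
have -> : (\sum_(j < m.+1) a j * Q ^ j =
           (\sum_(j < m) a j.+1 * Q ^ j) * Q + a 0)%N.
  rewrite big_ord_recl /= muln1 addnC; congr (_ + _)%N.
  by rewrite big_distrl /=; apply: eq_bigr => i _; rewrite expnSr mulnA.
have [lt dig] := IH (fun i => a i.+1) (fun i => aQ i.+1); split.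
  rewrite expnSr; apply: (@leq_trans ((\sum_(j < m) a j.+1 * Q ^ j).+1 * Q)).
    by rewrite mulSn addnC ltn_add2r.
  by rewrite leq_mul2r lt orbT.
case=> [|i] im; first by rewrite divn1 modnMDl modn_small.
by rewrite expnS divnMA divnMDl // (divn_small (aQ 0)) addn0 dig.
Qed.

Lemma point_countE (Q m : nat) (a : nat -> nat) : (1 < Q)%N ->
  (forall i, a i < Q)%N ->
  point_count Q (\sum_(i < m) a i * Q ^ i) =
    \sum_(i < m) (a i)%:R * q ^+ (2 * i).
Proof.
move=> Q1 aQ; have [lt dig] := digitsP m aQ.
rewrite -(expansion_widen Q1 lt).
by apply: eq_bigr => i _; rewrite dig.
Qed.

End QuantumGroup.

Arguments q {R}.

Section TensorProductVariety.

Variables (R : realType) (F : finFieldType) (k : nat) (d : {ffun 'I_k -> nat}).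
Variable D : vectType F.

(* With the indices of ['I_k] counted from 1, [Dlo fl i] and [Dhi fl i] are the
   steps [D_(i - 1)] and [D_i] of the flag [0 = D_0 <= ... <= D_k]. *)
Definition Dlo (fl : {ffun 'I_k.+1 -> {vspace D}}) (i : 'I_k) : {vspace D} :=
  fl (widen_ord (leqnSn k) i).
Definition Dhi (fl : {ffun 'I_k.+1 -> {vspace D}}) (i : 'I_k) : {vspace D} :=
  fl (lift ord0 i).

Definition is_flag (fl : {ffun 'I_k.+1 -> {vspace D}}) : bool :=
  [&& fl ord0 == 0%VS, fl ord_max == fullv &
   [forall i : 'I_k, (Dlo fl i <= Dhi fl i)%VS &&
      (\dim (Dhi fl i) - \dim (Dlo fl i) == d i)%N]].

Definition in_tpv
    (x : {ffun 'I_k.+1 -> {vspace D}} * {vspace D} * 'End(D)) : bool :=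
  let: (fl, W, t) := x in
  [&& is_flag fl, [forall i : 'I_k, (t @: Dhi fl i <= Dlo fl i)%VS],
      (limg t <= W)%VS & (W <= lker t)%VS].

Definition tpv := {x | in_tpv x}.

Definition tflag (x : tpv) : {ffun 'I_k.+1 -> {vspace D}} := (val x).1.1.
Definition tW (x : tpv) : {vspace D} := (val x).1.2.
Definition tend (x : tpv) : 'End(D) := (val x).2.

Definition GL := {g : 'End(D) | lker g == 0%VS}.

Definition GL_triple (g : 'End(D))
    (x : {ffun 'I_k.+1 -> {vspace D}} * {vspace D} * 'End(D)) :=
  ([ffun j => (g @: x.1.1 j)%VS], (g @: x.1.2)%VS, (g \o x.2 \o g^-1)%VF).

Lemma GL_tripleP (g : GL) (x : tpv) : in_tpv (GL_triple (val g) (val x)).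
Proof.
case: g x => g g0 [[[fl W] t] /= /and4P[/and3P[/eqP f0 /eqP f1 /forallP fd]
  /forallP ft tW Wt]].
have gdim U : \dim (g @: U) = \dim U.
  by apply: limg_dim_eq; rewrite (eqP g0) capv0.
have gt U : ((g \o t \o g^-1) @: (g @: U) = g @: (t @: U))%VS.
  by rewrite -[LHS]limg_comp lker0_compfVK // limg_comp.
rewrite /GL_triple /=; apply/and4P; split.
- apply/and3P; split; rewrite ?ffunE ?f0 ?f1 ?limg0 ?lker0_limgf //.
  apply/forallP => i; case/andP: (fd i) => le dm.
  by rewrite /Dlo /Dhi !ffunE limgS //= !gdim.
- by apply/forallP => i; rewrite /Dlo /Dhi !ffunE gt limgS // ft.
- by rewrite -[X in limg X]comp_lfunA limg_comp limgS // (subv_trans _ tW) //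
    limg_comp limgS // subvf.
apply/subvP => _ /memv_imgP[u uW ->]; rewrite memv_ker !lfunE /= !lfunE /=.
rewrite lker0_lfunK //.
by move/subvP/(_ _ uW): Wt; rewrite memv_ker => /eqP ->; rewrite linear0.
Qed.

Definition GL_act (g : GL) (x : tpv) : tpv := exist in_tpv _ (GL_tripleP g x).

Definition tfun := {ffun tpv -> (Cq R)^o}.

(* As [g] and [y] vary, [GL_act g y] is an arbitrary point [x], and [y] is the
   translate of [x] by the inverse of [g]. *)
Definition GL_invariant : {pred tfun} :=
  fun f => [forall g, forall y, f y == f (GL_act g y)].

(* The sum of the values of [f] on the finite set [A]: each value counts with the
   number of points of [A] at which it is taken. *)
Definition qsum (A : {set tpv}) (f : tfun) : Cq R :=
  \sum_(c <- undup [seq f y | y in A])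
    point_count R #|F| #|[set y in A | f y == c]| * c.

(* A subspace [U] belonging to the projective space [P_1] or [P_2] at
   [x = (D, W, t)] is represented by the point [(D, U, t)] of the variety. *)
Definition P1 (x : tpv) : {set tpv} :=
  [set y | [&& tflag y == tflag x, tend y == tend x, (tW x <= tW y)%VS,
               (tW y <= lker (tend x))%VS & \dim (tW y) == (\dim (tW x)).+1]].
Definition P2 (x : tpv) : {set tpv} :=
  [set y | [&& tflag y == tflag x, tend y == tend x, (limg (tend x) <= tW y)%VS,
               (tW y <= tW x)%VS & (\dim (tW y)).+1 == \dim (tW x)]].

Definition dimP1 (x : tpv) : int :=
  (\dim (lker (tend x)))%:Z - (\dim (tW x))%:Z - 1.
Definition dimP2 (x : tpv) : int :=
  (\dim (tW x))%:Z - (\dim (limg (tend x)))%:Z - 1.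

Definition weight (x : tpv) : int :=
  (\sum_i d i)%N%:Z - (\dim (tW x))%:Z *+ 2.

Definition tpv_act (g : Ugen) (f : tfun) : tfun :=
  [ffun x => match g with
   | U1 => f x
   | UE => q ^ (- dimP1 x) * qsum (P1 x) f
   | UF => q ^ (- dimP2 x) * qsum (P2 x) f
   | UK => q ^ weight x * f x
   | UKi => q ^ (- weight x) * f x
   end].

Definition alpha (X : {vspace D}) (fl : {ffun 'I_k.+1 -> {vspace D}}) :
    {ffun 'I_k -> nat} :=
  [ffun i => (\dim (X :&: Dhi fl i) - \dim (X :&: Dlo fl i))%N].

Definition Aset (w r n : {ffun 'I_k -> nat}) : {set tpv} :=
  [set x | [&& alpha (tW x) (tflag x) == w,
               alpha (limg (tend x)) (tflag x) == r &
               alpha (lker (tend x)) (tflag x) == n]].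

Definition basic_exp (w r n : {ffun 'I_k -> nat}) : int :=
  \sum_(i < k) \sum_(j < k | (i < j)%N)
    ((r i * w j)%N%:Z + (w i * n j)%N%:Z - (w i * w j)%N%:Z).

Definition basic (w r n : {ffun 'I_k -> nat}) : tfun :=
  [ffun x => q ^ basic_exp w r n * (x \in Aset w r n)%:R].

Definition basic_span (r n : {ffun 'I_k -> nat}) : {pred tfun} :=
  fun f => `[< exists (s : seq {ffun 'I_k -> nat})
                      (c : {ffun 'I_k -> nat} -> Cq R),
                 f = \sum_(w <- s) c w *: basic w r n >].

End TensorProductVariety.

(* Main.v *)
Require Import Defs.
From mathcomp Require Import all_boot all_order all_algebra.
From mathcomp Require Import boolp reals complex.
From mathcomp Require Import finfield zify ring.

(** By invariance, the value of an invariant function at [(D, W, t)] only depends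
    on the flag, on [t] and on [w = alpha(W, D)]: two subspaces between [im t] and
    [ker t] with the same [w] are exchanged by a linear automorphism which
    preserves the flag and commutes with [t]. The sum over the projective space
    [P_1] (or [P_2]) is thus a sum over the Schubert cells [w + e_i] (or
    [w - e_i]), and these are differences of consecutive projective spaces: with
    [s_i = \sum_(j < i) (n_j - w_j)], the cell of [w + e_i] has
    [\sum_(s_i <= a < s_(i + 1)) Q ^ a] points. On a fixed flag and [t], [E] and
    [F] become explicit difference operators in [w], for which the commutation
    relation reduces to a telescoping sum, and which the normalization of the
    basic functions turns into the iterated comultiplication. *)

Set Implicit Arguments.
Unset Strict Implicit.
Unset Printing Implicit Defensive.

Import GRing.Theory.

Local Open Scope ring_scope.

(** * Counting subspaces over a finite field *)

(** The obstacle is that [qsum] is not linear: each level set of [f] is counted as a whole, through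
    the base [Q] digits of its cardinality, and several cells may share a value of [f]. For an
    invariant function this does no harm, because different cells have disjoint exponent ranges:
    every digit is 0 or 1, no carry occurs, and each cell contributes separately whatever values
    coincide. For [E] the cell of [w + e_i] yields [q] to the power [\sum_(j < i) (n_j - w_j) -
    \sum_(j > i) (n_j - w_j)], whereas the comultiplication asks for
    [\sum_(j < i) (n_j + r_j - 2 w_j)]. The exponent in [basic] is a quadratic form whose increment
    from [w] to [w + e_i] is exactly the difference; the same form then settles [F]. The isomorphism
    reads coordinates on the fiber of one base point. It is thus defined on all functions, and no
    basis of the span has to be chosen. *)

Section CountSubspaces.

Variables (F : finFieldType) (D : vectType F).
Implicit Types U V W X Y : {vspace D}.
Local Notation Q := #|F|.
Local Notation fD := (finvect_type D).

Lemma card_mem_vspace V : #|[set v : fD | (v : D) \in V]| = (Q ^ \dim V)%N.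
Proof. by rewrite cardsE; case: D V => T c V; apply: (card_vspace (T := finvect_type _)). Qed.

(** The number of points of a projective space of dimension [m - 1]. *)
Definition pcard (m : nat) : nat := \sum_(a < m) Q ^ a.

Lemma pcardE m : (pcard m * (Q - 1) = Q ^ m - 1)%N.
Proof. by rewrite mulnC subn1 /pcard -predn_exp subn1. Qed.

Lemma card_F_gt1 : (1 < Q)%N.
Proof. exact: finNzRing_gt1. Qed.

Definition above W X : {set {vspace D}} :=
  [set U | [&& (W <= U)%VS, (U <= X)%VS & \dim U == (\dim W).+1]].

Definition below Y W : {set {vspace D}} :=
  [set U | [&& (Y <= U)%VS, (U <= W)%VS & (\dim U).+1 == \dim W]].

Lemma dim_add_line W v : v \notin W -> \dim (W + <[v]>) = (\dim W).+1.
Proof.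
move=> vW; have v0 : v != 0 by apply: contraNneq vW => ->; apply: mem0v.
rewrite dimv_disjoint_sum ?dim_vline ?v0 ?addn1 //.
apply/eqP; rewrite -subv0; apply/subvP => u /memv_capP[uW /vlineP[c uc]].
case: (eqVneq c 0) => [c0|c0]; first by rewrite uc c0 scale0r mem0v.
by case/negP: vW; rewrite -[v](scalerK c0) -uc memvZ.
Qed.

Lemma card_diff_vspace W X : (W <= X)%VS ->
  #|[set v : fD | ((v : D) \in X) && ((v : D) \notin W)]| =
  (Q ^ \dim X - Q ^ \dim W)%N.
Proof.
move=> WX; rewrite -!card_mem_vspace.
rewrite -(cardsID [set v : fD | (v : D) \in W] [set v : fD | (v : D) \in X]).
rewrite (_ : _ :&: _ = [set v : fD | (v : D) \in W]) ?addKn.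
  by apply: eq_card => v; rewrite !inE andbC.
by apply/setP => v; rewrite !inE andb_idl // => /(subvP WX).
Qed.

(** The vectors [v] of [X] outside [W] are sorted by the subspace [W + <[v]>]; each [U] receives
    [Q ^ (\dim W).+1 - Q ^ \dim W] of them. *)
Lemma card_above W X : (W <= X)%VS -> #|above W X| = pcard (\dim X - \dim W).
Proof.
move=> WX; pose S := [set v : fD | ((v : D) \in X) && ((v : D) \notin W)].
have cS : #|S| = (\sum_(U in above W X) (Q ^ (\dim W).+1 - Q ^ \dim W))%N.
  rewrite -sum1_card (partition_big (fun v : fD => (W + <[v : D]>)%VS)
    (mem (above W X))) /=.
    apply: eq_bigr => U; rewrite !inE => /and3P[WU UX /eqP dU].
    rewrite -dU -card_diff_vspace // -sum1_card; apply: eq_bigl => v.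
    rewrite !inE; apply/idP/idP => [/andP[/andP[vX vW] /eqP <-]|/andP[vU vW]].
      by rewrite vW andbT (subvP (addvSr W <[v : D]>)) ?memv_line.
    rewrite vW (subvP UX _ vU) /= eqEdim subv_add WU -memvE vU /=.
    by rewrite dim_add_line // dU.
  move=> v; rewrite !inE => /andP[vX vW].
  by rewrite addvSl subv_add WX -memvE vX dim_add_line /=.
move: cS; rewrite sum_nat_const card_diff_vspace // => cS.
have Q1 := card_F_gt1; have dWX := dimvS WX.
apply/eqP; rewrite -(@eqn_pmul2r (Q - 1)) ?subn_gt0 // pcardE.
rewrite -(@eqn_pmul2r (Q ^ \dim W)) ?expn_gt0 ?(ltn_trans _ Q1) //.
rewrite -mulnA mulnBl mul1n -expnS -cS mulnBl mul1n -expnD.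
by rewrite subnK.
Qed.

(* Duality is avoided by double counting the pairs of a hyperplane and of a line
   above [Y] contained in it, by induction on [\dim W - \dim Y]. *)
Lemma card_below Y W : (Y <= W)%VS -> #|below Y W| = pcard (\dim W - \dim Y).
Proof.
have [m dm] := ubnP (\dim W - \dim Y); elim: m Y dm => // m IH Y dm YW.
have dYW := dimvS YW; rewrite ltnS in dm.
case: (posnP (\dim W - \dim Y)) => [d0|d0].
  rewrite d0 /pcard big_ord0; apply/eqP; rewrite cards_eq0 -subset0.
  apply/subsetP => U; rewrite !inE => /and3P[/dimvS YU _ /eqP]; lia.
(* In codimension one the factor that the double count cancels, [pcard 0], would be zero. *)
have [d1|d1] := eqVneq (\dim W - \dim Y)%N 1%N.
  rewrite d1 /pcard big_ord1 expn0; apply/eqP/cards1P; exists Y.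
  apply/setP => U; rewrite !inE.
  apply/and3P/eqP => [[YU UW /eqP dU]|->]; last by split=> //; apply/eqP; lia.
  by apply/esym/eqP; rewrite eqEdim YU; lia.
have E : (#|below Y W| * pcard (\dim W - \dim Y).-1 =
          #|above Y W| * pcard (\dim W - \dim Y).-1)%N.
  transitivity (\sum_(U in below Y W) \sum_(L in above Y W) (L <= U)%VS)%N.
    rewrite -sum_nat_const; apply: eq_bigr => U.
    rewrite !inE => /and3P[YU UW /eqP dU].
    rewrite (_ : _.-1 = (\dim U - \dim Y)%N) -?card_above //; last by lia.
    rewrite -sum1_card [LHS]big_mkcond [RHS]big_mkcond /=; apply: eq_bigr => L _.
    rewrite !inE; case: (boolP (L <= U)%VS) => LU; last by rewrite andbF; case: ifP.
    by rewrite (subv_trans LU UW); case: ifP.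
  rewrite exchange_big -sum_nat_const; apply: eq_bigr => L.
  rewrite !inE => /and3P[YL LW /eqP dL].
  rewrite (_ : _.-1 = (\dim W - \dim L)%N); last by lia.
  rewrite -IH //; last by rewrite dL; lia.
  rewrite -sum1_card [LHS]big_mkcond [RHS]big_mkcond /=; apply: eq_bigr => U _.
  rewrite !inE; case: (boolP (L <= U)%VS) => LU; last by case: ifP.
  by rewrite (subv_trans YL LU); case: ifP.
move/eqP: E; rewrite eqn_pmul2r ?card_above //; first by move/eqP.
have {d0 d1} : (0 < (\dim W - \dim Y).-1)%N by lia.
by case: (_.-1) => // n _; rewrite /pcard big_ord_recl expn0 ltn_addr.
Qed.

End CountSubspaces.

(** * Automorphisms preserving a filtration *)

Section Filtrations.

Variables (K : fieldType) (D : vectType K) (fn : nat -> {vspace D}).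
Hypothesis fnS : forall j, (fn j <= fn j.+1)%VS.
Hypothesis fn0 : fn 0 = 0%VS.
Implicit Types U V W X Y : {vspace D}.
Implicit Types g : 'End(D).

Lemma glue_lfun U V (g1 g2 : 'End(D)) : (U :&: V = 0)%VS ->
  exists g : 'End(D), {in U, g =1 g1} /\ {in V, g =1 g2}.
Proof.
move=> UV0; have VU0 : (V :&: U = 0)%VS by rewrite capvC.
have pi0 (A B : {vspace D}) v : (A :&: B = 0)%VS -> v \in A -> daddv_pi B A v = 0.
  move=> AB0 vA; have vAB : v \in (A + B)%VS by apply: (subvP (addvSl _ _)).
  have := daddv_pi_add AB0 vAB; rewrite daddv_pi_id //.
  by move/eqP; rewrite -subr_eq0 addrAC subrr add0r => /eqP.
exists ((g1 \o daddv_pi U V) + (g2 \o daddv_pi V U))%VF.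
split=> v vU; rewrite add_lfunE !comp_lfunE.
  by rewrite daddv_pi_id // (pi0 U V) // linear0 addr0.
by rewrite [daddv_pi V U v]daddv_pi_id // (pi0 V U) // linear0 add0r.
Qed.

(** The equality of dimensions sits inside the sigma type, so that a map can be picked for every
    pair in a family and the equality checked afterwards. *)
Lemma dim_eq_lfun U V : {g : 'End(D) | \dim U = \dim V -> (g @: U)%VS = V}.
Proof.
have [f hf] := linear_of_free (vbasis U) (vbasis V).
exists (linfun f) => dUV.
have fUV : map f (vbasis U) = vbasis V.
  by apply: hf; rewrite ?size_tuple // (basis_free (vbasisP U)).
rewrite -{1}(span_basis (vbasisP U)) limg_span.
rewrite (eq_map (lfunE f)) fUV.
exact: span_basis (vbasisP V).
Qed.

(* The new directions of [Y] at step [j.+1] that do not come from [X]; on such a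
   piece a filtered map extending a given map on [X] can be chosen freely. *)
Definition piece X Y j : {vspace D} :=
  ((Y :&: fn j.+1) :\: (X :&: fn j.+1 + Y :&: fn j))%VS.

Section Piece.

Variables (X Y : {vspace D}).
Hypothesis XY : (X <= Y)%VS.

Lemma piece_sub j : (X :&: fn j.+1 + Y :&: fn j <= Y :&: fn j.+1)%VS.
Proof. by rewrite subv_add !capvS. Qed.

Lemma piece_split j :
  (piece X Y j + (X :&: fn j.+1 + Y :&: fn j))%VS = (Y :&: fn j.+1)%VS.
Proof. by rewrite addv_diff; apply/addv_idPl/piece_sub. Qed.

(** Since [X <= Y], the two summands removed in [piece] meet in [X :&: fn j]. The size of a piece is
    thus determined by dimensions along the filtration. *)
Lemma dim_piece j : (\dim (piece X Y j) + \dim (X :&: fn j.+1) +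
  \dim (Y :&: fn j) = \dim (Y :&: fn j.+1) + \dim (X :&: fn j))%N.
Proof.
have E := dimv_sum_cap (X :&: fn j.+1) (Y :&: fn j).
have capE : (X :&: fn j.+1 :&: (Y :&: fn j) = X :&: fn j)%VS.
  rewrite capvA -(capvA X) (capvC (fn _)) capvA (capv_idPl XY) -capvA.
  by rewrite (capv_idPr (fnS j)).
have P := dimv_cap_compl (Y :&: fn j.+1) (X :&: fn j.+1 + Y :&: fn j).
rewrite (capv_idPr (piece_sub j)) -/(piece X Y j) in P.
by rewrite capE in E; lia.
Qed.

(** The piece of step [m] meets [X + Y :&: fn m] trivially, and all earlier pieces lie in that sum:
    the map already built is kept there and prescribed freely on the new piece. *)
Lemma filtered_glue (g0 : 'End(D)) (psi : nat -> 'End(D)) m :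
  exists g : 'End(D), {in X, g =1 g0} /\
    forall j, (j < m)%N -> {in piece X Y j, g =1 psi j}.
Proof.
elim: m => [|m [g [gX gp]]]; first by exists g0.
have disj : ((X + Y :&: fn m) :&: piece X Y m = 0)%VS.
  apply/eqP; rewrite -subv0; apply/subvP => v.
  case/memv_capP => /memv_addP[x xX [y yY vE]] vp.
  have /memv_capP[vY vm] : v \in (Y :&: fn m.+1)%VS by apply: subvP vp; apply: diffvSl.
  have ym : y \in fn m.+1.
    by apply: subvP (fnS m) _ _; case/memv_capP: yY.
  rewrite -(capv_diff (Y :&: fn m.+1) (X :&: fn m.+1 + Y :&: fn m)) memv_cap vp /=.
  rewrite vE memv_add // memv_cap xX (_ : x = v - y) ?memvB //.
  by rewrite vE addrK.
have [h [h1 h2]] := glue_lfun g (psi m) disj.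
exists h; split=> [x xX|j]; first by rewrite h1 ?gX // (subvP (addvSl _ _)).
rewrite ltnS leq_eqVlt => /orP[/eqP -> //|jm v vp]; rewrite h1 ?(gp j jm) //.
move: v vp; apply/subvP; apply: subv_trans (diffvSl _ _) _.
apply: subv_trans (addvSr _ _); apply: capvS => //.
elim: m jm {gp disj h1 h2} => // m IH.
rewrite ltnS leq_eqVlt => /orP[/eqP -> //|/IH jm].
exact: subv_trans jm (fnS m).
Qed.

(** The identity of [X] is extended by zero on every piece. *)
Lemma filtered_proj m : exists p : 'End(D), {in X, p =1 id} /\
  forall j, (j <= m)%N -> (p @: (Y :&: fn j) <= X :&: fn j)%VS.
Proof.
have [p [pX pp]] := filtered_glue \1%VF (fun _ => 0) m.
have {}pX : {in X, p =1 id} by move=> x /pX ->; rewrite id_lfunE.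
exists p; split=> //; elim=> [|j IH] jm; first by rewrite fn0 capv0 limg0 sub0v.
rewrite -piece_split 2!limgD !subv_add (eq_in_limg (pp j jm)) lim0g sub0v /=.
apply/andP; split; last by apply: subv_trans (IH (ltnW jm)) _; rewrite capvS.
apply/subvP => _ /memv_imgP[x xX ->].
by rewrite pX //; case/memv_capP: xX.
Qed.

End Piece.

(** Corresponding pieces have the same dimension by [dim_piece], so maps carrying one onto the other
    can be glued to [g0]. *)
Lemma filtered_iso X X' Y Y' (g0 : 'End(D)) m :
  (X <= Y)%VS -> (X' <= Y')%VS ->
  (forall j, \dim (Y :&: fn j) = \dim (Y' :&: fn j)) ->
  (forall j, \dim (X :&: fn j) = \dim (X' :&: fn j)) ->
  (forall j, (j <= m)%N -> (g0 @: (X :&: fn j) = X' :&: fn j)%VS) ->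
  exists g : 'End(D), {in X, g =1 g0} /\
    forall j, (j <= m)%N -> (g @: (Y :&: fn j) = Y' :&: fn j)%VS.
Proof.
move=> XY XY' dY dX g0X.
have [g [gX gp]] := filtered_glue X Y g0
  (fun j => sval (dim_eq_lfun (piece X Y j) (piece X' Y' j))) m.
exists g; split=> //; elim=> [|j IH] jm; first by rewrite fn0 !capv0 limg0.
rewrite -(piece_split XY) -(piece_split XY') 2!limgD IH ?(ltnW jm) //.
have -> : (g @: (X :&: fn j.+1) = X' :&: fn j.+1)%VS.
  rewrite -g0X //; apply: eq_in_limg => x /memv_capP[xX _]; exact: gX.
rewrite (eq_in_limg (gp j jm)) (svalP (dim_eq_lfun _ _)) //.
have := dim_piece XY j; have := dim_piece XY' j; rewrite !dY !dX; lia.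
Qed.

(* [g] is [1 + (h - 1) p], where [h] maps [W] to [W'] inside the kernel of [t]
   and fixes the image of [t], and [p] is a filtered projection on the kernel. *)
Lemma filtered_transport m (t : 'End(D)) W W' :
  fn m = fullv -> (limg t <= W)%VS -> (W <= lker t)%VS ->
  (limg t <= W')%VS -> (W' <= lker t)%VS ->
  (forall j, \dim (W :&: fn j) = \dim (W' :&: fn j)) ->
  exists g : 'End(D), [/\ lker g == 0%VS, (g @: W)%VS = W',
    (forall j, (j <= m)%N -> (g @: fn j)%VS = fn j),
    (g \o t)%VF = t & (t \o g)%VF = t].
Proof.
move=> fm tW Wt tW' Wt' dW.
(* Two successive extensions: from the identity of the image of [t] to [W -> W'], then to the kernel
   of [t]. *)
have [h1 [h1i h1W]] := @filtered_iso (limg t) (limg t) W W' \1%VF m tW tW' dW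
  (fun _ => erefl) (fun _ _ => lim1g _).
have [h [hW hK]] := @filtered_iso W W' (lker t) (lker t) h1 m Wt Wt'
  (fun _ => erefl) dW h1W.
have [p [pK pf]] := filtered_proj (subvf (lker t)) m.
have hi : {in limg t, h =1 id}.
  by move=> v vt; rewrite hW ?(subvP tW) // h1i // id_lfunE.
have hKK : (h @: lker t = lker t)%VS by have := hK m (leqnn m); rewrite fm !capvf.
have pD v : p v \in lker t.
  have := pf m (leqnn m); rewrite fm !capvf => /subvP; apply.
  by rewrite memv_img ?memvf.
pose g := (\1 + ((h - \1) \o p))%VF.
have gE v : g v = v + (h (p v) - p v).
  by rewrite /g add_lfunE comp_lfunE add_lfunE opp_lfunE !id_lfunE.
have gK : {in lker t, g =1 h} by move=> v vK; rewrite gE pK // addrC subrK.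
have tg : (t \o g)%VF = t.
  apply/lfunP => v; rewrite comp_lfunE gE !linearD /= linearN /=.
  have /eqP -> : t (h (p v)) == 0 by rewrite -memv_ker -hKK memv_img.
  by have /eqP -> : t (p v) == 0; [rewrite -memv_ker|rewrite subrr addr0].
(* A vector killed by [g] is killed by [t \o g], which is [t], so it lies in the kernel of [t];
   there [g] is [h], which maps this kernel onto itself and hence is injective on it. *)
have g0 : lker g == 0%VS.
  rewrite -subv0; apply/subvP => v; rewrite memv_ker => /eqP gv.
  have vK : v \in lker t by rewrite memv_ker -tg comp_lfunE gv linear0.
  have : v \in (lker t :&: lker h)%VS by rewrite memv_cap vK memv_ker -(gK v vK) gv eqxx.
  suff -> : (lker t :&: lker h = 0)%VS by [].
  apply/eqP; rewrite -dimv_eq0; have := limg_ker_dim h (lker t).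
  by rewrite hKK; lia.
exists g; split=> //.
- rewrite (eq_in_limg (g := h1)).
    by have := h1W m (leqnn m); rewrite fm !capvf.
  by move=> v vW; rewrite gK ?hW // (subvP Wt).
- move=> j jm; apply/eqP; rewrite eqEdim limg_dim_eq ?(eqP g0) ?capv0 // leqnn andbT.
  apply/subvP => _ /memv_imgP[v vj ->]; rewrite gE.
  have pv : p v \in (lker t :&: fn j)%VS.
    by apply: subvP (pf j jm) _ _; rewrite memv_img // memv_cap memvf.
  have hv : h (p v) \in (lker t :&: fn j)%VS by rewrite -(hK j jm) memv_img.
  case/memv_capP: pv => _ pv; case/memv_capP: hv => _ hv.
  by rewrite memvD // memvB.
apply/lfunP => v; rewrite comp_lfunE; have tv : t v \in limg t by rewrite memv_img ?memvf.
by rewrite gK ?hi // (subvP Wt) // (subvP tW).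
Qed.

End Filtrations.

(** * Points of the tensor product variety *)

Section TensorProductVarietyPoints.

Variables (R : realType) (F : finFieldType) (k : nat) (d : {ffun 'I_k -> nat}).
Variable D : vectType F.
Implicit Types fl : {ffun 'I_k.+1 -> {vspace D}}.
Implicit Types x y : tpv d D.
Implicit Types f : tfun R d D.
Implicit Types U W X Y : {vspace D}.

(** The flag as a filtration indexed by all natural numbers, constant from [k] on, to which the
    results on filtrations apply. *)
Definition fstep fl (j : nat) : {vspace D} := fl (inord (minn j k)).

Lemma Dlo_fstep fl (i : 'I_k) : Dlo fl i = fstep fl i.
Proof.
rewrite /Dlo /fstep; congr (fl _); apply: val_inj; rewrite /= inordK.
  by rewrite (minn_idPl _) // ltnW.
by rewrite ltnS geq_minr.
Qed.

Lemma Dhi_fstep fl (i : 'I_k) : Dhi fl i = fstep fl i.+1.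
Proof.
rewrite /Dhi /fstep; congr (fl _); apply: val_inj; rewrite /= inordK.
  by rewrite (minn_idPl _).
by rewrite ltnS geq_minr.
Qed.

Section Flag.

Variable fl : {ffun 'I_k.+1 -> {vspace D}}.
Hypothesis flag_fl : is_flag d fl.

Lemma fstep0 : fstep fl 0 = 0%VS.
Proof.
case/and3P: flag_fl => /eqP <- _ _; rewrite /fstep; congr (fl _).
by apply: val_inj; rewrite /= inordK min0n.
Qed.

Lemma fstep_ge j : (k <= j)%N -> fstep fl j = fullv.
Proof.
move=> kj; case/and3P: flag_fl => _ /eqP <- _; rewrite /fstep; congr (fl _).
by apply: val_inj; rewrite /= inordK (minn_idPr _).
Qed.

Lemma fstepS j : (fstep fl j <= fstep fl j.+1)%VS.
Proof.
have [jk|kj] := ltnP j k; last by rewrite [X in (_ <= X)%VS]fstep_ge ?subvf // leqW.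
case/and3P: flag_fl => _ _ /forallP/(_ (Ordinal jk))/andP[].
by rewrite Dlo_fstep Dhi_fstep.
Qed.

Lemma fstep_mono j l : (j <= l)%N -> (fstep fl j <= fstep fl l)%VS.
Proof.
elim: l => [|l IH]; first by rewrite leqn0 => /eqP ->.
rewrite leq_eqVlt => /orP[/eqP -> //|/IH jl].
exact: subv_trans jl (fstepS l).
Qed.

Definition psum (u : {ffun 'I_k -> nat}) (j : nat) : nat :=
  \sum_(i < k | (i < j)%N) u i.

Lemma psum0 u : psum u 0 = 0%N.
Proof. by rewrite /psum big_pred0. Qed.

Lemma psumS u (i : 'I_k) : psum u i.+1 = (psum u i + u i)%N.
Proof.
rewrite /psum (bigD1 i) //= addnC; congr (_ + _)%N.
by apply: eq_bigl => j; rewrite ltnS andbC -ltn_neqAle.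
Qed.

Lemma psum_ge u j : (k <= j)%N -> psum u j = (\sum_i u i)%N.
Proof. by move=> kj; apply: eq_bigl => i; rewrite (leq_trans (ltn_ord i)). Qed.

Lemma alphaE X (i : 'I_k) :
  alpha X fl i = (\dim (X :&: fstep fl i.+1) - \dim (X :&: fstep fl i))%N.
Proof. by rewrite ffunE Dlo_fstep Dhi_fstep. Qed.

Lemma dim_capS X j :
  (\dim (X :&: fstep fl j) <= \dim (X :&: fstep fl j.+1))%N.
Proof. by rewrite dimvS // capvS // fstepS. Qed.

Lemma dim_cap_psum X j : \dim (X :&: fstep fl j) = psum (alpha X fl) j.
Proof.
elim: j => [|j IH]; first by rewrite fstep0 capv0 dimv0 psum0.
have [jk|kj] := ltnP j k.
  rewrite (psumS _ (Ordinal jk)) -IH alphaE /= addnC subnK //; exact: dim_capS.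
by move: IH; rewrite !fstep_ge ?(leqW kj) // => ->; rewrite !psum_ge // leqW.
Qed.

Lemma dim_alpha X : \dim X = (\sum_i alpha X fl i)%N.
Proof. by rewrite -(psum_ge _ (leqnn k)) -dim_cap_psum fstep_ge // capvf. Qed.

(** The difference of the two sides is the dimension of [piece X Y i]. *)
Lemma alpha_le X Y i : (X <= Y)%VS -> (alpha X fl i <= alpha Y fl i)%N.
Proof.
move=> XY; have P := dim_piece fstepS XY i.
have := dim_capS X i; have := dim_capS Y i; rewrite !alphaE; lia.
Qed.

End Flag.

Lemma tpvP x : [/\ is_flag d (tflag x), (limg (tend x) <= tW x)%VS &
  (tW x <= lker (tend x))%VS].
Proof. by case: x => [[[fl W] t] h]; case/and4P: (h). Qed.

Lemma tpv_eq x y :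
  tflag x = tflag y -> tend x = tend y -> tW x = tW y -> x = y.
Proof.
case: x y => [[[fl W] t] h] [[[fl' W'] t'] h'] /= e1 e2 e3; apply: val_inj => /=.
by move: e1 e2 e3; rewrite /tflag /tW /tend /= => -> -> ->.
Qed.

(** The default [x] is returned when the modified triple is not a point of the variety. *)
Definition setW x U : tpv d D := insubd x (tflag x, U, tend x).

Lemma val_setW x U : (limg (tend x) <= U)%VS -> (U <= lker (tend x))%VS ->
  val (setW x U) = (tflag x, U, tend x).
Proof.
move=> tU Ut; rewrite val_insubd ifT //.
by case: x tU Ut => [[[fl W] t] h]; case/and4P: (h) => h1 h2 _ _ h3 h4; apply/and4P.
Qed.

Definition wt x := alpha (tW x) (tflag x).
Definition rt x := alpha (limg (tend x)) (tflag x).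
Definition nt x := alpha (lker (tend x)) (tflag x).

Lemma rt_le_wt x i : (rt x i <= wt x i)%N.
Proof. by case: (tpvP x) => fx tW _; apply: alpha_le. Qed.

Lemma wt_le_nt x i : (wt x i <= nt x i)%N.
Proof. by case: (tpvP x) => fx _ Wt; apply: alpha_le. Qed.

Lemma invariant_fiber f x y : f \in @GL_invariant R F k d D ->
  tflag y = tflag x -> tend y = tend x -> wt y = wt x -> f y = f x.
Proof.
move=> finv efl et ew.
case: (tpvP x) (tpvP y) => fx tWx Wtx [fy tWy Wty]; rewrite et in tWy Wty.
have dW j : \dim (tW x :&: fstep (tflag x) j) = \dim (tW y :&: fstep (tflag x) j).
  by rewrite !(dim_cap_psum fx) -/(wt x) -ew -efl.
have [g [g0 gW gfl gt tg]] := filtered_transport (fstepS fx) (fstep0 fx)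
  (fstep_ge fx (leqnn k)) tWx Wtx tWy Wty dW.
pose gG : GL D := exist _ g g0.
move: finv; rewrite unfold_in => /forallP/(_ gG)/forallP/(_ x)/eqP ->.
congr (f _); apply: tpv_eq; rewrite /tflag /tend /tW /=.
- rewrite -/(tflag x) -/(tflag y) efl; apply/ffunP => j; rewrite ffunE.
  have jk : (j <= k)%N by rewrite -ltnS.
  by have := gfl j jk; rewrite /fstep (minn_idPl jk) inord_val.
- by rewrite -/(tend x) -/(tend y) gt -{1}tg lker0_compfK.
by rewrite -/(tW x) -/(tW y) gW.
Qed.

Lemma alpha_GL (g : 'End(D)) X fl : lker g == 0%VS ->
  alpha (g @: X) [ffun j => (g @: fl j)%VS] = alpha X fl.
Proof.
move=> g0; apply/ffunP => i; rewrite !ffunE /Dlo /Dhi !ffunE -!lker0_img_cap //.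
by rewrite !limg_dim_eq ?(eqP g0) ?capv0.
Qed.

Lemma limg_conj (g t : 'End(D)) : lker g == 0%VS ->
  (limg (g \o t \o g^-1) = g @: limg t)%VS.
Proof.
move=> g0; rewrite -{1}(lker0_limgf g0) -limg_comp lker0_compfVK //.
by rewrite limg_comp.
Qed.

Lemma lker_conj (g t : 'End(D)) : lker g == 0%VS ->
  (lker (g \o t \o g^-1) = g @: lker t)%VS.
Proof.
move=> g0; have gI : injective g by apply/lker0P.
apply/vspaceP => v; rewrite memv_ker !comp_lfunE.
apply/eqP/memv_imgP => [|[u ut ->]].
  rewrite -[X in _ = X](linear0 g) => /gI tv.
  by exists (g^-1%VF v); rewrite ?memv_ker ?tv ?lker0_lfunVK.
by rewrite lker0_lfunK //; move: ut; rewrite memv_ker => /eqP ->; rewrite linear0.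
Qed.

Section GLAction.

Variables (g : GL D) (x : tpv d D).

Lemma wt_GL : wt (GL_act g x) = wt x.
Proof. exact: alpha_GL (svalP g). Qed.

Lemma rt_GL : rt (GL_act g x) = rt x.
Proof. by rewrite /rt /tend /= limg_conj ?(svalP g) //; exact: alpha_GL (svalP g). Qed.

Lemma nt_GL : nt (GL_act g x) = nt x.
Proof. by rewrite /nt /tend /= lker_conj ?(svalP g) //; exact: alpha_GL (svalP g). Qed.

Lemma GL_act_fiber y : tflag y = tflag x -> tend y = tend x ->
  tflag (GL_act g y) = tflag (GL_act g x) /\ tend (GL_act g y) = tend (GL_act g x).
Proof. by rewrite /tflag /tend /= => -> ->. Qed.

End GLAction.

Definition incr (w : {ffun 'I_k -> nat}) (i : 'I_k) : {ffun 'I_k -> nat} :=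
  [ffun j => w j + (j == i)]%N.
(** Truncated at 0. When [r <= w], the truncation only occurs where [w i = r i = 0], and there the
    coefficient [[w i - r i]] of [F] vanishes. *)
Definition decr (w : {ffun 'I_k -> nat}) (i : 'I_k) : {ffun 'I_k -> nat} :=
  [ffun j => w j - (j == i)]%N.

(* The classes of the points of [P1 x] and of [P2 x] according to the value of
   [wt], cut out by the conditions [tW y <= fup x j] (resp. [fdn x j <= tW y]),
   which only ever change once along the flag. *)
Definition fup x j := (tW x + lker (tend x) :&: fstep (tflag x) j)%VS.
Definition fdn x j := (limg (tend x) + tW x :&: fstep (tflag x) j)%VS.

Lemma dim_fup x j : \dim (fup x j) = (\dim (tW x) + psum (nt x) j - psum (wt x) j)%N.
Proof.
case: (tpvP x) => fx tW Wt; rewrite -!(dim_cap_psum fx).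
have := dimv_sum_cap (Defs.tW x) (lker (tend x) :&: fstep (tflag x) j).
rewrite capvA (capv_idPl Wt) -/(fup x j); lia.
Qed.

Lemma dim_fdn x j : \dim (fdn x j) =
  (\dim (limg (tend x)) + psum (wt x) j - psum (rt x) j)%N.
Proof.
case: (tpvP x) => fx tW Wt; rewrite -!(dim_cap_psum fx).
have := dimv_sum_cap (limg (tend x)) (Defs.tW x :&: fstep (tflag x) j).
rewrite capvA (capv_idPl tW) -/(fdn x j); lia.
Qed.

Lemma leq_psum (u v : {ffun 'I_k -> nat}) j :
  (forall i, (u i <= v i)%N) -> (psum u j <= psum v j)%N.
Proof. by move=> uv; apply: leq_sum. Qed.

Lemma card_P1_sub x Z : (tW x <= Z)%VS -> (Z <= lker (tend x))%VS ->
  #|[set y in P1 x | (tW y <= Z)%VS]| = pcard F (\dim Z - \dim (tW x)).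
Proof.
move=> WZ Zt; rewrite -card_above //; case: (tpvP x) => fx tWx Wtx.
have vS U : U \in above (tW x) Z -> val (setW x U) = (tflag x, U, tend x).
  rewrite inE => /and3P[WU UZ _].
  by rewrite val_setW ?(subv_trans tWx) ?(subv_trans UZ).
rewrite -(card_in_imset (f := setW x)).
  apply: eq_card => y; apply/idP/imsetP => [|[U UA ->]].
    rewrite !inE => /andP[/and5P[/eqP fy /eqP ty Wy yt dy] yZ].
    exists (tW y); first by rewrite inE Wy yZ.
    have v := vS (tW y); rewrite inE Wy yZ dy in v.
    by apply: tpv_eq; rewrite /tflag /tend /tW v.
  rewrite inE inE;
  have [-> -> ->] : [/\ tflag (setW x U) = tflag x, tend (setW x U) = tend x &
      tW (setW x U) = U] by split; rewrite /tflag /tend /tW vS.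
  move: UA; rewrite !inE => /and3P[-> UZ ->].
  by rewrite !eqxx UZ (subv_trans UZ).
by move=> U U' /vS e /vS e' /(congr1 (fun z => (val z).1.2)); rewrite e e'.
Qed.

Lemma card_P2_sup x Z : (limg (tend x) <= Z)%VS -> (Z <= tW x)%VS ->
  #|[set y in P2 x | (Z <= tW y)%VS]| = pcard F (\dim (tW x) - \dim Z).
Proof.
move=> tZ ZW; rewrite -card_below //; case: (tpvP x) => fx tWx Wtx.
have vS U : U \in below Z (tW x) -> val (setW x U) = (tflag x, U, tend x).
  rewrite inE => /and3P[ZU UW _].
  by rewrite val_setW ?(subv_trans tZ) ?(subv_trans UW).
rewrite -(card_in_imset (f := setW x)).
  apply: eq_card => y; apply/idP/imsetP => [|[U UA ->]].
    rewrite !inE => /andP[/and5P[/eqP fy /eqP ty Wy yt dy] yZ].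
    exists (tW y); first by rewrite inE yt yZ.
    have v := vS (tW y); rewrite inE yt yZ dy in v.
    by apply: tpv_eq; rewrite /tflag /tend /tW v.
  rewrite inE inE;
  have [-> -> ->] : [/\ tflag (setW x U) = tflag x, tend (setW x U) = tend x &
      tW (setW x U) = U] by split; rewrite /tflag /tend /tW vS.
  move: UA; rewrite !inE => /and3P[ZU -> ->].
  by rewrite !eqxx ZU (subv_trans tZ).
by move=> U U' /vS e /vS e' /(congr1 (fun z => (val z).1.2)); rewrite e e'.
Qed.

End TensorProductVarietyPoints.

(** * Schubert cells and sums over them *)

(** A monotone boolean sequence starting at [false] jumps at most once. This serves both to find the
    one cell containing a given subspace and to see that a given exponent occurs in at most one
    cell. *)
Lemma sum_jump (b : nat -> bool) m : b 0%N = false ->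
  (forall i, b i -> b i.+1) -> (\sum_(i < m) (b i.+1 && ~~ b i) = b m)%N.
Proof.
move=> b0 bS; elim: m => [|m IH]; first by rewrite big_ord0 b0.
rewrite big_ord_recr /= IH; have := bS m.
by case: (b m) => [->|_]; rewrite ?andbT.
Qed.

Section Classes.

Variables (R : realType) (F : finFieldType) (k : nat) (d : {ffun 'I_k -> nat}).
Variable D : vectType F.
Implicit Types x y : tpv d D.
Implicit Types f : tfun R d D.
Local Notation Q := #|F|.

(** * Cells of the projective space of lines in the kernel of [t] modulo [W] *)

Section Up.

Variables x : tpv d D.

Definition up_jump (i : 'I_k) y :=
  (tW y <= fup x i.+1)%VS && ~~ (tW y <= fup x i)%VS.
Definition up_lo (j : nat) := (psum (nt x) j - psum (wt x) j)%N.

Lemma fup_le j : (fup x j <= lker (tend x))%VS.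
Proof. by case: (tpvP x) => _ _ Wt; rewrite subv_add Wt capvSl. Qed.

Lemma fupS j : (fup x j <= fup x j.+1)%VS.
Proof. by case: (tpvP x) => fx _ _; rewrite addvS // capvS // (fstepS fx). Qed.

Lemma up_loS j : (up_lo j <= up_lo j.+1)%N.
Proof.
case: (tpvP x) => _ tW Wt; have := dimvS (fupS j); rewrite !dim_fup /up_lo.
have := leq_psum j (@wt_le_nt _ _ _ _ x); have := leq_psum j.+1 (@wt_le_nt _ _ _ _ x).
lia.
Qed.

Lemma dim_fup_lo j : (\dim (fup x j) - \dim (tW x) = up_lo j)%N.
Proof.
by rewrite dim_fup /up_lo; have := leq_psum j (@wt_le_nt _ _ _ _ x); lia.
Qed.

Lemma card_up_jump i :
  #|[set y in P1 x | up_jump i y]| = (\sum_(up_lo i <= a < up_lo i.+1) Q ^ a)%N.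
Proof.
have cE j : #|[set y in P1 x | (tW y <= fup x j)%VS]| = pcard F (up_lo j).
  by rewrite card_P1_sub ?fup_le ?addvSl // dim_fup_lo.
have := cE i.+1; rewrite -(cardsID [set y | (tW y <= fup x i)%VS]).
rewrite (_ : _ :&: _ = [set y in P1 x | (tW y <= fup x i)%VS]); last first.
  apply/setP => y; rewrite !inE; case: (boolP (tW y <= fup x i)%VS) => yi.
    by rewrite (subv_trans yi (fupS i)) !andbT.
  by rewrite !andbF.
rewrite (_ : _ :\: _ = [set y in P1 x | up_jump i y]); last first.
  by apply/setP => y; rewrite !inE /up_jump andbCA [~~ _ && _]andbC.
rewrite cE /pcard -!(big_mkord xpredT (fun a => Q ^ a)%N).
by rewrite (big_cat_nat (n := up_lo i) (p := up_lo i.+1)) //= ?up_loS // => /addnI.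
Qed.

Section Member.

Variable y : tpv d D.
Hypothesis yP1 : y \in P1 x.

Lemma P1_props : [/\ tflag y = tflag x, tend y = tend x, (tW x <= tW y)%VS,
  (tW y <= lker (tend x))%VS & \dim (tW y) = (\dim (tW x)).+1].
Proof. by move: yP1; rewrite inE => /and5P[/eqP ? /eqP ? ? ? /eqP ?]. Qed.

(** The quotient of [tW y] by [tW x] is a line, so the part of [tW y] in step [j] maps to it either
    by zero or onto; it maps onto exactly when [tW y <= fup x j]. *)
Lemma dim_cap_up j : \dim (tW y :&: fstep (tflag x) j) =
  (\dim (tW x :&: fstep (tflag x) j) + (tW y <= fup x j)%VS)%N.
Proof.
have [_ _ Wy yt dy] := P1_props; set S := fstep _ j.
have E := dimv_sum_cap (tW x) (tW y :&: S).
rewrite capvA (capv_idPl Wy) in E.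
have ltW : (tW x <= tW x + tW y :&: S)%VS by rewrite addvSl.
have leW : (tW x + tW y :&: S <= tW y)%VS by rewrite subv_add Wy capvSl.
case: (boolP (tW y <= _)%VS) => yu.
  suff e : (tW x + tW y :&: S)%VS = tW y by rewrite e in E; lia.
  apply/eqP; rewrite eqEsubv leW; apply/subvP => v vy.
  have /memv_addP[w wW [u /memv_capP[ut uS] vE]] := subvP yu _ vy.
  have uE : u = v - w by rewrite vE addrAC subrr add0r.
  rewrite vE memv_add // memv_cap uS andbT uE memvB //.
  exact: (subvP Wy).
have ne : (tW x + tW y :&: S)%VS != tW y.
  by apply: contraNneq yu => <-; rewrite addvS // capvS.
move: ne; rewrite eqEdim leW -ltnNge => lt.
by have := dimvS ltW; rewrite /= in lt *; lia.
Qed.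

Lemma sum_up_jump : (\sum_i up_jump i y = 1)%N.
Proof.
have [_ _ Wy yt dy] := P1_props; case: (tpvP x) => fx _ _.
rewrite (@sum_jump (fun j => (tW y <= fup x j)%VS)).
- by rewrite /fup (fstep_ge fx) // capvf (subv_trans yt) ?addvSr.
- rewrite /fup (fstep0 fx) capv0 addv0; apply/negP => /dimvS; lia.
by move=> i yi; apply: subv_trans yi (fupS i).
Qed.

Lemma fup_mono j l : (j <= l)%N -> (fup x j <= fup x l)%VS.
Proof.
by move=> jl; case: (tpvP x) => fx _ _; rewrite addvS // capvS // (fstep_mono fx).
Qed.

Lemma wt_up_jump i : up_jump i y -> wt y = incr (wt x) i.
Proof.
case/andP=> yhi ylo; have [ef _ _ _ _] := P1_props; case: (tpvP x) => fx _ _.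
apply/ffunP => j; rewrite [RHS]ffunE /wt ef !alphaE !dim_cap_up -val_eqE.
have := dim_capS fx (tW x) j; case: (ltngtP j i) => [ji|ij|->].
- have n1 : (tW y <= fup x j.+1)%VS = false.
    by apply: contraNF ylo => h; apply: subv_trans h (fup_mono ji).
  have n2 : (tW y <= fup x j)%VS = false.
    by apply: contraNF ylo => h; apply: subv_trans h (fup_mono (ltnW ji)).
  by rewrite n1 n2; lia.
- have p2 := subv_trans yhi (fup_mono ij).
  by rewrite (subv_trans p2 (fupS j)) p2; lia.
by rewrite yhi (negbTE ylo); lia.
Qed.

End Member.

End Up.

(** * Cells of the dual projective space of hyperplanes of [W] containing the image of [t] *)

Section Down.

Variables x : tpv d D.

(** Containment of [fdn x j] is lost, not gained, along the flag. The cells are therefore met in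
    decreasing order of exponents, those of cell [i] running from [down_lo i.+1] to [down_lo i]. *)
Definition down_jump (i : 'I_k) y :=
  ~~ (fdn x i.+1 <= tW y)%VS && (fdn x i <= tW y)%VS.
Definition down_lo (j : nat) := (\dim (tW x) - \dim (fdn x j))%N.

Lemma fdn_le j : (fdn x j <= tW x)%VS.
Proof. by case: (tpvP x) => _ tW _; rewrite subv_add tW capvSl. Qed.

Lemma fdn_mono j l : (j <= l)%N -> (fdn x j <= fdn x l)%VS.
Proof.
by move=> jl; case: (tpvP x) => fx _ _; rewrite addvS // capvS // (fstep_mono fx).
Qed.

Lemma down_loS j : (down_lo j.+1 <= down_lo j)%N.
Proof. by rewrite /down_lo leq_sub2l // dimvS // fdn_mono. Qed.

Lemma card_down_jump i :
  #|[set y in P2 x | down_jump i y]| =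
  (\sum_(down_lo i.+1 <= a < down_lo i) Q ^ a)%N.
Proof.
have cE j : #|[set y in P2 x | (fdn x j <= tW y)%VS]| = pcard F (down_lo j).
  by rewrite card_P2_sup ?fdn_le ?addvSl.
have := cE i; rewrite -(cardsID [set y | (fdn x i.+1 <= tW y)%VS]).
rewrite (_ : _ :&: _ = [set y in P2 x | (fdn x i.+1 <= tW y)%VS]); last first.
  apply/setP => y; rewrite !inE; case: (boolP (fdn x i.+1 <= tW y)%VS) => yi.
    by rewrite (subv_trans (fdn_mono (leqnSn i)) yi) !andbT.
  by rewrite !andbF.
rewrite (_ : _ :\: _ = [set y in P2 x | down_jump i y]); last first.
  by apply/setP => y; rewrite !inE /down_jump andbCA.
rewrite cE /pcard -!(big_mkord xpredT (fun a => Q ^ a)%N).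
by rewrite (big_cat_nat (n := down_lo i.+1) (p := down_lo i)) //= ?down_loS // => /addnI.
Qed.

Section Member.

Variable y : tpv d D.
Hypothesis yP2 : y \in P2 x.

Lemma P2_props : [/\ tflag y = tflag x, tend y = tend x,
  (limg (tend x) <= tW y)%VS, (tW y <= tW x)%VS & (\dim (tW y)).+1 = \dim (tW x)].
Proof. by move: yP2; rewrite inE => /and5P[/eqP ? /eqP ? ? ? /eqP ?]. Qed.

(** The part of [tW x] in step [j], modulo that of [tW y], embeds in a line, and is zero exactly
    when [tW y] contains it. *)
Lemma dim_cap_down j : \dim (tW x :&: fstep (tflag x) j) =
  (\dim (tW y :&: fstep (tflag x) j) + ~~ (fdn x j <= tW y)%VS)%N.
Proof.
have [_ _ ty yW dy] := P2_props; set S := fstep _ j.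
have E := dimv_sum_cap (tW y) (tW x :&: S).
rewrite capvA (capv_idPl yW) in E.
have leW : (tW y + tW x :&: S <= tW x)%VS by rewrite subv_add yW capvSl.
rewrite /fdn subv_add ty /=; case: (boolP (tW x :&: S <= tW y)%VS) => Wy.
  by rewrite (addv_idPl Wy) in E; rewrite /= in E *; lia.
have : \dim (tW y + tW x :&: S) != \dim (tW y).
  apply: contraNneq Wy => e; have /eqP -> : tW y == (tW y + tW x :&: S)%VS.
    by rewrite eqEdim addvSl e /=.
  exact: addvSr.
by have := dimvS leW; have := dimvS (addvSl (tW y) (tW x :&: S)); rewrite /= in E *; lia.
Qed.

Lemma sum_down_jump : (\sum_i down_jump i y = 1)%N.
Proof.
have [_ _ ty yW dy] := P2_props; case: (tpvP x) => fx tWx _.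
rewrite (eq_bigr (fun i : 'I_k =>
    (~~ (fdn x i.+1 <= tW y)%VS && ~~ ~~ (fdn x i <= tW y)%VS : nat)));
  last by move=> i _; rewrite negbK.
rewrite (@sum_jump (fun j => ~~ (fdn x j <= tW y)%VS)).
- rewrite /fdn (fstep_ge fx) // capvf subv_add ty /=.
  by case: (boolP (tW x <= tW y)%VS) => // /dimvS; lia.
- by rewrite /fdn (fstep0 fx) capv0 addv0 ty.
by move=> i; apply: contraNN => yi; apply: subv_trans (fdn_mono (leqnSn i)) yi.
Qed.

Lemma wt_down_jump i : down_jump i y -> wt x = incr (wt y) i.
Proof.
case/andP=> yhi ylo; have [ef _ _ _ _] := P2_props; case: (tpvP x) => fx _ _.
apply/ffunP => j; rewrite [RHS]ffunE /wt ef !alphaE !dim_cap_down -val_eqE.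
have := dim_capS fx (tW y) j; case: (ltngtP j i) => [ji|ij|->].
- have p1 := subv_trans (fdn_mono ji) ylo.
  by rewrite (subv_trans (fdn_mono (leqnSn j)) p1) p1 /=; lia.
- have n1 : (fdn x j <= tW y)%VS = false.
    by apply: contraNF yhi => h; apply: subv_trans (fdn_mono ij) h.
  have n2 : (fdn x j.+1 <= tW y)%VS = false.
    by apply: contraNF yhi => h; apply: subv_trans (fdn_mono (leqW ij)) h.
  by rewrite n1 n2 /=; lia.
by rewrite (negbTE yhi) ylo /=; lia.
Qed.

End Member.

End Down.

(** The level set of [c] is the union of the classes [i] with [v i = c]. By disjointness of the
    ranges its cardinality is a sum of distinct powers of [Q], which [point_countE] reads off digit
    by digit; exchanging the sums over values and classes then makes the values disappear. The
    result is linear in [v], although [qsum] is not linear in [f]. *)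
Lemma qsum_classes (A : {set tpv d D}) (B : 'I_k -> pred (tpv d D))
    (lo hi : 'I_k -> nat) (v : 'I_k -> Cq R) (f : tfun R d D) :
  {in A, forall y, \sum_i B i y = 1}%N ->
  (forall a, \sum_i (lo i <= a < hi i) <= 1)%N ->
  (forall i, #|[set y in A | B i y]| = \sum_(lo i <= a < hi i) Q ^ a)%N ->
  (forall i, {in A, forall y, B i y -> f y = v i}) ->
  qsum A f = \sum_i (\sum_(lo i <= a < hi i) q ^+ (2 * a)) * v i.
Proof.
(* A common bound for all exponents, so that every sum runs over the same index set. *)
move=> B1 lohi cB fv; pose m := (\max_i hi i)%N.
have bigE (V : nmodType) (G : nat -> V) i :
    \sum_(lo i <= a < hi i) G a = \sum_(a < m) G a *+ (lo i <= a < hi i).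
  rewrite -(big_mkord xpredT (fun a => G a *+ (lo i <= a < hi i))).
  rewrite [LHS](big_nat_widen _ _ m) ?leq_bigmax // [LHS](big_nat_widenl _ 0) //.
  rewrite [LHS]big_mkcond [LHS]big_nat [RHS]big_nat; apply: eq_bigr => a _ /=.
  by rewrite andbC; case: (_ && _).
have cA c : #|[set y in A | f y == c]| =
    (\sum_(a < m) (\sum_(i | v i == c) (lo i <= a < hi i)) * Q ^ a)%N.
  transitivity (\sum_(i | v i == c) #|[set y in A | B i y]|)%N.
    rewrite -sum1_card big_mkcond /=.
    transitivity (\sum_(y in A) \sum_(i | v i == c) B i y)%N.
      rewrite [RHS]big_mkcond /=; apply: eq_bigr => y _; rewrite inE.
      case: (boolP (y \in A)) => //= yA; rewrite -[LHS]/((f y == c) : nat).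
      have -> : (f y == c : nat) = (\sum_i (f y == c) * B i y)%N.
        by rewrite -big_distrr /= B1 // muln1.
      rewrite [RHS]big_mkcond; apply: eq_bigr => i _.
      case Bi: (B i y); last by rewrite muln0; case: ifP.
      by rewrite (fv i) // muln1; case: ifP.
    rewrite exchange_big; apply: eq_bigr => i _ /=.
    rewrite -sum1_card [LHS]big_mkcond [RHS]big_mkcond; apply: eq_bigr => y _.
    by rewrite inE; case: (y \in A) => //=; case: (B i y).
  rewrite (eq_bigr _ (fun i _ => cB i)) (eq_bigr _ (fun i _ => bigE _ _ i)).
  rewrite exchange_big; apply: eq_bigr => a _ /=.
  rewrite big_distrl /=; apply: eq_bigr => i _.
  by case: (_ <= _ < _)%N; rewrite ?mulr1n ?mul1n ?mulr0n ?mul0n.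
rewrite /qsum.
have dig c a : (\sum_(i | v i == c) (lo i <= a < hi i) < Q)%N.
  apply: leq_ltn_trans (card_F_gt1 F); apply: leq_trans (lohi a).
  by rewrite [X in (_ <= X)%N](bigID (fun i => v i == c)) leq_addr.
rewrite (eq_bigr (fun c =>
    \sum_i (\sum_(lo i <= a < hi i) q ^+ (2 * a)) * (c *+ (v i == c)))); last first.
  move=> c _; rewrite cA (point_countE R m (card_F_gt1 F) (dig c)).
  rewrite big_distrl /= [RHS](eq_bigr (fun i => \sum_(a < m)
     (lo i <= a < hi i)%:R * q ^+ (2 * a) * (c *+ (v i == c)))); last first.
    move=> i _; rewrite bigE big_distrl; apply: eq_bigr => a _.
    by rewrite [in RHS]mulr_natl.
  rewrite exchange_big; apply: eq_bigr => a _ /=.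
  rewrite natr_sum !big_distrl /= [LHS]big_mkcond; apply: eq_bigr => i _.
  by case: ifP; rewrite ?mulr1n // mulr0n mulr0.
rewrite exchange_big; apply: eq_bigr => i _ /=.
rewrite -big_distrr /=.
(* The value [v i] of an empty class need not be taken by [f] on [A], but then its range of
   exponents is empty too. *)
case: (eqVneq (\sum_(lo i <= a < hi i) Q ^ a)%N 0%N) => [lohi_i|].
  have hl : (hi i <= lo i)%N.
    rewrite leqNgt; apply/negP => lh; move: lohi_i; rewrite big_ltn // => /eqP.
    by rewrite addn_eq0 expn_eq0 => /andP[]; have := card_F_gt1 F; case: #|F|.
  by rewrite big_geq // !mul0r.
rewrite -cB cards_eq0 => /set0Pn[y]; rewrite inE => /andP[yA Bi].
have vin : v i \in undup [seq f y | y in A].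
  by rewrite mem_undup -(fv i y yA Bi) image_f.
rewrite (bigD1_seq (v i)) ?undup_uniq //= eqxx mulr1n; congr (_ * _).
by rewrite big1 ?addr0 // => c; rewrite eq_sym => /negbTE ->.
Qed.

End Classes.

(** * The operators on the fibers *)

Lemma subV_neq0 (K : fieldType) (x : K) : x != 0 -> x ^+ 2 != 1 -> x - x^-1 != 0.
Proof.
move=> x0; apply: contraNneq => /eqP; rewrite subr_eq0 => /eqP xV.
by rewrite expr2 {1}xV mulVf.
Qed.

(** * Geometric sums and quantum integers *)

Section LaurentSums.

Variables (K : fieldType) (x : K).
Hypothesis x0 : x != 0.
Hypothesis xx : x - x^-1 != 0.

(** Multiplication by [x - x^-1] makes the sum telescope. The power [lo + hi - 1] is the mean of the
    exponents, and what remains is symmetric under inversion of [x]. *)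
Lemma geometric_qint (lo hi : nat) : (lo <= hi)%N ->
  \sum_(lo <= a < hi) x ^+ (2 * a) =
  x ^ (lo%:Z + hi%:Z - 1) *
    ((x ^ (hi%:Z - lo%:Z) - x ^ (- (hi%:Z - lo%:Z))) / (x - x^-1)).
Proof.
move=> lohi; apply: (mulIf xx).
rewrite mulrA mulfVK // [in RHS]mulrBr -!expfzDr // big_distrl /=.
pose u (a : nat) := x ^ (2 * a%:Z - 1).
rewrite (eq_bigr (fun a => u a.+1 - u a)).
  by rewrite telescope_sumr // /u; congr (x ^ _ - x ^ _); lia.
move=> a _; rewrite /u mulrBr; congr (_ - _).
  by rewrite -exprSr exprnP; congr (_ ^ _); lia.
by rewrite -exprN1 exprnP -expfzDr //; congr (_ ^ _); lia.
Qed.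

Lemma qint_at0 : (x ^ 0 - x ^ (- 0)) / (x - x^-1) = 0.
Proof. by rewrite oppr0 subrr mul0r. Qed.

(** The identity behind the commutation relation: it is applied with [a = n_i - w_i] and
    [b = w_i - r_i], so that [a - b] is the weight [n_i + r_i - 2 w_i] of the factor [i]. *)
Lemma qint_exchange (a b : int) (qi := fun n => (x ^ n - x ^ (- n)) / (x - x^-1)) :
  qi a * qi (b + 1) - qi b * qi (a + 1) = qi (a - b).
Proof.
have xx' : x * x - 1 != 0.
  by move: xx; rewrite -(inj_eq (mulIf x0)) mulrBl mulVf // mul0r.
rewrite /qi !(opprD, opprK) !expfzDr // -!invr_expz expr1z.
have := expfz_neq0 a x0; have := expfz_neq0 b x0.
move: (x ^ a) (x ^ b) => y z y0 z0.
by field; rewrite x0 xx' y0 z0.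
Qed.

End LaurentSums.

Section QuantumIntegers.

Variable R : realType.
Local Notation q := (@q R).
Local Notation qint := (@qint R).

Lemma q_neq0 : q != 0.
Proof. by rewrite /Defs.q tofrac_eq0 polyX_eq0. Qed.

Lemma qE (a b : int) : q ^ (a + b) = q ^ a * q ^ b.
Proof. by rewrite expfzDr ?q_neq0. Qed.

Lemma q_sub_inv_neq0 : q - q^-1 != 0.
Proof.
apply: subV_neq0 q_neq0 _; rewrite /Defs.q -tofracXn -tofrac1 tofrac_eq.
by apply/eqP => /(congr1 (size \o val)); rewrite /= size_polyXn size_poly1.
Qed.

Lemma qint0 : qint 0 = 0.
Proof. exact: qint_at0. Qed.

Lemma qpart (lo hi : nat) : (lo <= hi)%N ->
  \sum_(lo <= a < hi) q ^+ (2 * a) =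
  q ^ (lo%:Z + hi%:Z - 1) * qint (hi%:Z - lo%:Z).
Proof. by move=> lohi; apply: geometric_qint => //; [exact: q_neq0|exact: q_sub_inv_neq0]. Qed.

End QuantumIntegers.

Section Action.

Variables (R : realType) (F : finFieldType) (k : nat) (d : {ffun 'I_k -> nat}).
Variable D : vectType F.
Implicit Types x y : tpv d D.
Implicit Types f : tfun R d D.
Implicit Types r n w : {ffun 'I_k -> nat}.
Local Notation q := (@q R).
Local Notation inv := (@GL_invariant R F k d D).

Definition gsum w (i : 'I_k) : nat := \sum_(j < k | (i < j)%N) w j.

Lemma sum_psum_gsum w (i : 'I_k) : (\sum_j w j = psum w i + w i + gsum w i)%N.
Proof.
rewrite (bigID (fun j : 'I_k => (j < i)%N)) /= -addnA; congr (_ + _)%N.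
rewrite (bigD1 i) ?ltnn //=; congr (_ + _)%N.
by apply: eq_bigl => j; rewrite -leqNgt ltn_neqAle eq_sym andbC val_eqE.
Qed.

Definition fiber x w : pred (tpv d D) :=
  [pred y | [&& tflag y == tflag x, tend y == tend x & wt y == w]].

(** For invariant [f] the choice of [y] does not matter. The value 0 on an empty fiber mirrors the
    convention that [v_m = 0] outside the weights of [V_e]. *)
Definition fval f x w : Cq R := if [pick y in fiber x w] is Some y then f y else 0.

Definition in_range r n w := [forall i, r i <= w i <= n i]%N.

Lemma in_rangeP r n w : reflect (forall i, (r i <= w i <= n i)%N) (in_range r n w).
Proof. exact: forallP. Qed.

Lemma in_range_wt x : in_range (rt x) (nt x) (wt x).
Proof. by apply/in_rangeP => i; rewrite rt_le_wt wt_le_nt. Qed.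

Lemma fiberP x w y : reflect [/\ tflag y = tflag x, tend y = tend x & wt y = w]
  (y \in fiber x w).
Proof. by apply: (iffP and3P) => -[/eqP ? /eqP ? /eqP ?]. Qed.

Lemma fiber_rt_nt x w y : y \in fiber x w -> rt y = rt x /\ nt y = nt x.
Proof. by case/fiberP => e1 e2 _; rewrite /rt /nt e1 e2. Qed.

(** One climbs from the image of [t], whose type is [rt x]: as long as [wt y i < w i], the cell
    [up_jump y i] has a positive number of points, and any of them raises the entry [i] by one. *)
Lemma fiber_exists x w : in_range (rt x) (nt x) w -> exists y, y \in fiber x w.
Proof.
move=> /in_rangeP w_in; case: (tpvP x) => fx tWx Wtx.
have [m] := ubnP (\sum_i (w i - rt x i))%N.
have : exists2 y, y \in fiber x (wt y) & (forall i, wt y i <= w i)%N /\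
    (\sum_i (w i - wt y i) = \sum_i (w i - rt x i))%N.
  have tt := subv_trans tWx Wtx; have v := val_setW (subvv _) tt.
  have e : wt (setW x (limg (tend x))) = rt x.
    by rewrite /wt /tW /tflag v.
  exists (setW x (limg (tend x))).
    by apply/fiberP; rewrite /tflag /tend v.
  by rewrite e; split=> // i; case/andP: (w_in i).
case=> y yf [yw <-]; elim: m y yf yw => // m IH y yf yw.
rewrite ltnS => sm; have [ey|] := eqVneq (wt y) w; first by exists y; rewrite -ey.
move=> yNw; have [i wi] : exists i, (wt y i < w i)%N.
  apply/existsP; apply: contraNT yNw; rewrite negb_exists => /forallP h.
  by apply/eqP/ffunP => i; apply/eqP; rewrite eqn_leq yw leqNgt h.
have [_ en] := fiber_rt_nt yf.
have : [set z in P1 y | up_jump y i z] != set0.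
  rewrite -cards_eq0 card_up_jump -lt0n big_ltn; last first.
    rewrite /up_lo !psumS; have := leq_psum i (@wt_le_nt _ _ _ _ y).
    by case/andP: (w_in i); rewrite -en; lia.
  by rewrite ltn_addr // expn_gt0; have := card_F_gt1 F; case: #|F|.
case/set0Pn => z; rewrite inE => /andP[zP zi].
have [e1 e2 _ _ _] := P1_props zP; have ez := wt_up_jump zP zi.
case/fiberP: yf => e1' e2' _.
apply: (IH z).
- by apply/fiberP; rewrite e1 e2.
- by move=> j; rewrite ez ffunE; case: (eqVneq j i) => [->|]; rewrite ?addn1 ?addn0.
apply: leq_trans sm; rewrite (bigD1 i) //= [X in (_ < X)%N](bigD1 i) //=.
rewrite ez ffunE eqxx (eq_bigr (fun j => w j - wt y j)%N); first by move: wi => /=; lia.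
by move=> j /negbTE ji; rewrite ffunE ji addn0.
Qed.

Lemma fiber_range x w y : y \in fiber x w -> in_range (rt x) (nt x) w.
Proof.
by move=> yf; have [<- <-] := fiber_rt_nt yf; case/fiberP: yf => _ _ <-; exact: in_range_wt.
Qed.

Lemma fval_eq f x w y : f \in inv -> y \in fiber x w -> fval f x w = f y.
Proof.
move=> finv yf; rewrite /fval; case: pickP => [z zf|/(_ y)]; last by rewrite yf.
case/fiberP: yf => e1 e2 e3; case/fiberP: zf => e1' e2' e3'.
by apply: (invariant_fiber finv); rewrite ?e1 ?e2 ?e3.
Qed.

Lemma fval_out f x w : ~~ in_range (rt x) (nt x) w -> fval f x w = 0.
Proof.
move=> w_out; rewrite /fval; case: pickP => // y yf.
by rewrite (fiber_range yf) in w_out.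
Qed.

Lemma fval_fiber f x y w w' : y \in fiber x w -> fval f y w' = fval f x w'.
Proof. by case/fiberP => e1 e2 _; rewrite /fval /fiber e1 e2. Qed.

Lemma fval_GL f (g : GL D) x w : f \in inv -> fval f (GL_act g x) w = fval f x w.
Proof.
move=> finv; case: (boolP (in_range (rt x) (nt x) w)) => w_in; last first.
  by rewrite !fval_out ?rt_GL ?nt_GL.
have [y yf] := fiber_exists w_in; rewrite (fval_eq finv yf).
rewrite (@fval_eq _ _ _ (GL_act g y)) //.
  by move: finv; rewrite unfold_in => /forallP/(_ g)/forallP/(_ y)/eqP ->.
case/fiberP: yf => e1 e2 e3; have [e4 e5] := GL_act_fiber g e1 e2.
by apply/fiberP; rewrite wt_GL.
Qed.

Lemma fvalD f f' (a : Cq R) x w :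
  fval (a *: f + f') x w = a * fval f x w + fval f' x w.
Proof. by rewrite /fval; case: pickP => [y _|_]; rewrite ?ffunE // mulr0 addr0. Qed.

Lemma fiber_refl x : x \in fiber x (wt x).
Proof. exact/fiberP. Qed.

(** With [s] as above, the exponent is [s_i + s_(i + 1) - 1], from the geometric sum over the cell,
    minus the dimension [s_k - 1] of [P_1]. *)
Definition coefUE r n w (i : 'I_k) : Cq R :=
  q ^ ((psum n i)%:Z - (psum w i)%:Z - (gsum n i)%:Z + (gsum w i)%:Z) *
  qint R ((n i)%:Z - (w i)%:Z).

Definition coefUF r n w (i : 'I_k) : Cq R :=
  q ^ ((gsum w i)%:Z - (gsum r i)%:Z - (psum w i)%:Z + (psum r i)%:Z) *
  qint R ((w i)%:Z - (r i)%:Z).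

Lemma act_UE f x : f \in inv -> tpv_act UE f x =
  \sum_i coefUE (rt x) (nt x) (wt x) i * fval f x (incr (wt x) i).
Proof.
move=> finv; rewrite ffunE.
rewrite (@qsum_classes R F k d D (P1 x) (up_jump x) (fun i => up_lo x i)
  (fun i => up_lo x i.+1) (fun i => fval f x (incr (wt x) i))) //; first last.
- move=> i y yP yi; have [e1 e2 _ _ _] := P1_props yP.
  by apply/esym/fval_eq => //; apply/fiberP; rewrite (wt_up_jump yP yi).
- by move=> i; rewrite card_up_jump.
- move=> a; rewrite (eq_bigr (fun i : 'I_k =>
    ((a < up_lo x i.+1)%N && ~~ (a < up_lo x i)%N : nat))).
    rewrite (@sum_jump (fun j => a < up_lo x j)%N) ?leq_b1 //.
      by rewrite /up_lo !psum0.
    by move=> j aj; apply: leq_trans aj (up_loS x j).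
  by move=> i _; rewrite -leqNgt andbC.
- by move=> y yP; exact: sum_up_jump yP.
rewrite big_distrr; apply: eq_bigr => i _; rewrite /= mulrA; congr (_ * _).
case: (tpvP x) => fx _ _.
rewrite qpart ?up_loS // mulrA -qE /coefUE /up_lo psumS psumS /dimP1.
have := leq_psum i (@wt_le_nt _ _ _ _ x); have := @wt_le_nt _ _ _ _ x i.
rewrite (dim_alpha fx (tW x)) (dim_alpha fx (lker (tend x))) -/(wt x) -/(nt x).
rewrite !(sum_psum_gsum _ i) => h1 h2.
by congr (q ^ _ * qint R _); lia.
Qed.

Lemma act_UF f x : f \in inv -> tpv_act UF f x =
  \sum_i coefUF (rt x) (nt x) (wt x) i * fval f x (decr (wt x) i).
Proof.
move=> finv; rewrite ffunE.
rewrite (@qsum_classes R F k d D (P2 x) (down_jump x) (fun i => down_lo x i.+1)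
  (fun i => down_lo x i) (fun i => fval f x (decr (wt x) i))) //; first last.
- move=> i y yP yi; have [e1 e2 _ _ _] := P2_props yP.
  apply/esym/fval_eq => //; apply/fiberP; rewrite (wt_down_jump yP yi); split=> //.
  by apply/ffunP => j; rewrite !ffunE addnK.
- by move=> i; rewrite card_down_jump.
(* The bounds decrease here, so the monotone sequence is the negation of [a < down_lo x j]; the
   conjunct [a < down_lo x 0] makes it start at [false]. *)
- move=> a; rewrite (eq_bigr (fun i : 'I_k =>
    (((a < down_lo x 0)%N && ~~ (a < down_lo x i.+1)%N) &&
     ~~ ((a < down_lo x 0)%N && ~~ (a < down_lo x i)%N) : nat))).
    rewrite (@sum_jump (fun j => (a < down_lo x 0)%N && ~~ (a < down_lo x j)%N)) ?leq_b1 //.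
      by rewrite andbN.
    move=> j /andP[-> aj]; apply: contraNN aj => aj; apply: leq_trans aj (down_loS x j).
  move=> i _; rewrite -leqNgt; case: (ltnP a (down_lo x i)) => ai.
    have -> : (a < down_lo x 0)%N.
      by apply: leq_trans ai _; rewrite /down_lo leq_sub2l // dimvS // fdn_mono.
    by rewrite andbT.
  by rewrite andbF /= andbT; case: (a < _)%N; rewrite ?andbF.
- by move=> y yP; exact: sum_down_jump yP.
rewrite big_distrr; apply: eq_bigr => i _; rewrite /= mulrA; congr (_ * _).
case: (tpvP x) => fx _ _.
rewrite qpart ?down_loS // mulrA -qE /coefUF /down_lo !dim_fdn !psumS /dimP2.
have := leq_psum i (@rt_le_wt _ _ _ _ x); have := @rt_le_wt _ _ _ _ x i.
rewrite (dim_alpha fx (tW x)) (dim_alpha fx (limg (tend x))) -/(wt x) -/(rt x).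
have : (gsum (rt x) i <= gsum (wt x) i)%N.
  by apply: leq_sum => j _; exact: rt_le_wt.
rewrite !(sum_psum_gsum _ i) => h1 h2 h3.
by congr (q ^ _ * qint R _); lia.
Qed.

End Action.

(** * The commutation relation *)

Section Shift.

Variable k : nat.
Implicit Types (u w : {ffun 'I_k -> nat}) (i j : 'I_k).

Lemma incrK i : cancel (fun w => incr w i) (fun w => decr w i).
Proof. by move=> w; apply/ffunP => j; rewrite !ffunE addnK. Qed.

Lemma decrK w i : (0 < w i)%N -> incr (decr w i) i = w.
Proof.
by move=> wi; apply/ffunP => j; rewrite !ffunE; case: eqP => [->|_]; rewrite /=; lia.
Qed.

Lemma incr_decr w i j : i != j -> incr (decr w j) i = decr (incr w i) j.
Proof.
move=> ij; apply/ffunP => l; rewrite !ffunE.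
by case: (eqVneq l i) => [->|_]; rewrite ?(negbTE ij) /= ?subn0 ?addn0.
Qed.

Lemma sum_incr w i (P : pred 'I_k) :
  (\sum_(j | P j) incr w i j = \sum_(j | P j) w j + P i)%N.
Proof.
under eq_bigr do rewrite ffunE; rewrite big_split /=; congr (_ + _)%N.
rewrite big_mkcond (bigD1 i) //= eqxx big1 ?addn0; first by case: (P i).
by move=> j /negbTE ->; case: ifP.
Qed.

Lemma psum_incr w i j : psum (incr w i) j = (psum w j + (i < j))%N.
Proof. exact: sum_incr. Qed.

Lemma gsum_incr w i j : gsum (incr w i) j = (gsum w j + (j < i))%N.
Proof. exact: sum_incr. Qed.

Lemma incr_at w i : incr w i i = (w i).+1.
Proof. by rewrite ffunE eqxx addn1. Qed.

Lemma incr_ne w i j : j != i -> incr w i j = w j.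
Proof. by move=> /negbTE ji; rewrite ffunE ji addn0. Qed.

Lemma decr_at w i : decr w i i = (w i).-1.
Proof. by rewrite ffunE eqxx subn1. Qed.

Lemma decr_ne w i j : j != i -> decr w i j = w j.
Proof. by move=> /negbTE ji; rewrite ffunE ji subn0. Qed.

End Shift.

Section CommutatorEF.

Variables (K : fieldType) (x : K).
Hypothesis x0 : x != 0.
Hypothesis xx : x - x^-1 != 0.
Variables (k : nat) (r n : {ffun 'I_k -> nat}) (h : {ffun 'I_k -> nat} -> K).
Implicit Types (w : {ffun 'I_k -> nat}) (i j : 'I_k).

Let qi (a : int) : K := (x ^ a - x ^ (- a)) / (x - x^-1).
Let cE (w : {ffun 'I_k -> nat}) (i : 'I_k) : K :=
  x ^ ((psum n i)%:Z - (psum w i)%:Z - (gsum n i)%:Z + (gsum w i)%:Z) *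
  qi ((n i)%:Z - (w i)%:Z).
Let cF (w : {ffun 'I_k -> nat}) (i : 'I_k) : K :=
  x ^ ((gsum w i)%:Z - (gsum r i)%:Z - (psum w i)%:Z + (psum r i)%:Z) *
  qi ((w i)%:Z - (r i)%:Z).

Let qi0 : qi 0 = 0.
Proof. exact: qint_at0. Qed.

(** Each shift changes the exponent of the other coefficient by one, with opposite signs. Where
    [w j = r j], so that [decr] may truncate, both sides vanish. *)
Lemma EF_off_diagonal w i j : (r j <= w j)%N -> i != j ->
  cE w i * (cF (incr w i) j * h (decr (incr w i) j)) =
  cF w j * (cE (decr w j) i * h (incr (decr w j) i)).
Proof.
move=> rw ij; have ji : j != i by rewrite eq_sym.
have [rj|] := eqVneq (w j) (r j).
  by rewrite /cF incr_ne // rj subrr qi0 !(mulr0, mul0r).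
move=> wr; rewrite incr_decr // [LHS]mulrA [RHS]mulrA; congr (_ * _).
have : (0 < w j)%N by lia.
move/decrK; set u := decr w j => {wr rw} <-.
rewrite /cE /cF !psum_incr !gsum_incr !(incr_ne _ ij) !(incr_ne _ ji) !incr_at ltnn.
rewrite mulrACA -expfzDr // [RHS]mulrACA -expfzDr // [qi _ * qi _]mulrC.
congr (x ^ _ * _); move: ij; rewrite -val_eqE /=; case: (ltngtP i j) => //= _ _; lia.
Qed.

Lemma EF_diagonal w i : (r i <= w i)%N ->
  (cE w i * (cF (incr w i) i * h (decr (incr w i) i)) -
   cF w i * (cE (decr w i) i * h (incr (decr w i) i))) =
  x ^ ((psum n i)%:Z + (psum r i)%:Z - (psum w i)%:Z *+ 2 -
       ((gsum n i)%:Z + (gsum r i)%:Z - (gsum w i)%:Z *+ 2)) *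
  qi ((n i)%:Z + (r i)%:Z - (w i)%:Z *+ 2) * h w.
Proof.
move=> rw; rewrite incrK.
set e := (X in x ^ X).
have eA : cE w i * (cF (incr w i) i * h w) =
    x ^ e * (qi ((n i)%:Z - (w i)%:Z) * qi ((w i)%:Z - (r i)%:Z + 1)) * h w.
  rewrite /cE /cF psum_incr gsum_incr incr_at ltnn !addn0 [LHS]mulrA; congr (_ * _).
  rewrite mulrACA -expfzDr //; congr (x ^ _ * (qi _ * qi _)); rewrite /e; lia.
have eB : cF w i * (cE (decr w i) i * h (incr (decr w i) i)) =
    x ^ e * (qi ((w i)%:Z - (r i)%:Z) * qi ((n i)%:Z - (w i)%:Z + 1)) * h w.
  have [rj|wr] := eqVneq (w i) (r i).
    by rewrite /cF rj subrr qi0 !(mulr0, mul0r).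
  have : (0 < w i)%N by lia.
  move/decrK; set u := decr w i => {wr} wE; rewrite -wE [LHS]mulrA; congr (_ * _).
  rewrite /cE /cF /e -wE psum_incr gsum_incr incr_at ltnn !addn0.
  rewrite mulrACA -expfzDr //; congr (x ^ _ * (qi _ * qi _)); lia.
rewrite eA eB -mulrBl -mulrBr; congr (_ * _ * _).
rewrite (qint_exchange x0 xx) -/(qi _); congr (qi _); lia.
Qed.

Lemma EF_commutator w : (forall i, r i <= w i)%N ->
  \sum_i cE w i * (\sum_j cF (incr w i) j * h (decr (incr w i) j)) -
  \sum_j cF w j * (\sum_i cE (decr w j) i * h (incr (decr w j) i)) =
  (x - x^-1)^-1 *
    (x ^ ((\sum_i n i)%N%:Z + (\sum_i r i)%N%:Z - (\sum_i w i)%N%:Z *+ 2) * h w -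
     x ^ (- ((\sum_i n i)%N%:Z + (\sum_i r i)%N%:Z - (\sum_i w i)%N%:Z *+ 2)) * h w).
Proof.
move=> rw; set L := _ - _ *+ 2 in |- *.
under eq_bigr do rewrite big_distrr /=.
under [X in _ - X]eq_bigr do rewrite big_distrr /=.
rewrite [X in _ - X]exchange_big -sumrB /=.
(* The exponent is twice the partial sum of the weights [n_i + r_i - 2 w_i] minus their total [L].
   The term [i] is proportional to [G i.+1 - G i], while the ends are [G 0 = x ^ (- L)] and
   [G k = x ^ L]. *)
pose G (j : nat) := x ^ (((psum n j)%:Z + (psum r j)%:Z - (psum w j)%:Z *+ 2) *+ 2 - L).
rewrite (eq_bigr (fun i : 'I_k => (x - x^-1)^-1 * (G i.+1 - G i) * h w)).
  rewrite -big_distrl -big_distrr /= -mulrBl -mulrA; congr (_ * (_ * _)).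
  rewrite -(big_mkord xpredT (fun l : nat => G l.+1 - G l)) telescope_sumr //.
  by rewrite /G !psum0 !psum_ge // -/L; congr (x ^ _ - x ^ _); rewrite /L; lia.
move=> i _; rewrite -sumrB (bigD1 i) //= big1 ?addr0 => [|j ji]; last first.
  by rewrite EF_off_diagonal ?subrr // eq_sym.
rewrite EF_diagonal //; congr (_ * _); rewrite /qi mulrA mulrC; congr (_ * _).
rewrite mulrBr -!expfzDr // /G !psumS /L !(sum_psum_gsum _ i).
by congr (x ^ _ - x ^ _); lia.
Qed.

End CommutatorEF.

(** * The module of invariant functions *)

Lemma sum_coef_linear (K : fieldType) (I : finType) (c u v : I -> K) (a : K) :
  \sum_i c i * (a * u i + v i) = a * (\sum_i c i * u i) + \sum_i c i * v i.
Proof.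
by rewrite big_distrr -big_split; apply: eq_bigr => i _; rewrite mulrDr mulrCA.
Qed.

(** Restricting to nonzero coefficients excludes the truncated values of [decr], whose weight is not
    raised by 2. *)
Lemma sum_coef_scale_neq0 (K : fieldType) (I : finType) (c u v : I -> K) (a b : K) :
  (forall i, c i != 0 -> a * u i = b * v i) ->
  a * (\sum_i c i * u i) = b * (\sum_i c i * v i).
Proof.
move=> uv; rewrite !big_distrr; apply: eq_bigr => i _ /=.
have [-> |ci] := eqVneq (c i) 0; first by rewrite !(mul0r, mulr0).
by rewrite mulrCA uv // mulrCA.
Qed.

Section InvariantModule.

Variables (R : realType) (F : finFieldType) (k : nat) (d : {ffun 'I_k -> nat}).
Variable D : vectType F.
Hypothesis hD : \dim (fullv : {vspace D}) = (\sum_i d i)%N.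
Implicit Types x y : tpv d D.
Implicit Types f : tfun R d D.
Implicit Types (r n w : {ffun 'I_k -> nat}) (i j : 'I_k).
Local Notation q := (@q R).
Local Notation inv := (@GL_invariant R F k d D).
Local Notation act := (@tpv_act R F k d D).

Lemma GL_invariantP f : reflect (forall g x, f x = f (GL_act g x)) (f \in inv).
Proof.
rewrite unfold_in; apply: (iffP forallP) => [h g x|h g].
  by move/forallP: (h g) => /(_ x)/eqP.
by apply/forallP => x; apply/eqP.
Qed.

Lemma add_tfunE f f' x : (f + f') x = f x + f' x.
Proof. by rewrite ffunE. Qed.

Lemma sub_tfunE f f' x : (f - f') x = f x - f' x.
Proof. by rewrite !ffunE. Qed.

Lemma scale_tfunE (a : Cq R) f x : (a *: f) x = a * f x.
Proof. by rewrite ffunE. Qed.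

Definition wtsum r n w : int :=
  (\sum_i n i)%N%:Z + (\sum_i r i)%N%:Z - (\sum_i w i)%N%:Z *+ 2.

(** Rank-nullity: [d] is the sum of the dimensions of the image and of the kernel of [t]. *)
Lemma weightE x : weight x = wtsum (rt x) (nt x) (wt x).
Proof.
case: (tpvP x) => fx _ _; rewrite /weight /wtsum -!(dim_alpha fx) -hD.
by rewrite -(limg_ker_dim (tend x) fullv) capfv.
Qed.

Lemma weight_GL (g : GL D) x : weight (GL_act g x) = weight x.
Proof. by rewrite !weightE wt_GL rt_GL nt_GL. Qed.

Lemma act_invariant g f : f \in inv -> act g f \in inv.
Proof.
move=> finv; apply/GL_invariantP => h x; have fh := GL_invariantP _ finv h.
case: g.
- by rewrite [LHS]ffunE [RHS]ffunE.
- rewrite !(act_UE _ finv) rt_GL nt_GL wt_GL; apply: eq_bigr => i _.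
  by rewrite (fval_GL h x _ finv).
- rewrite !(act_UF _ finv) rt_GL nt_GL wt_GL; apply: eq_bigr => i _.
  by rewrite (fval_GL h x _ finv).
- by rewrite [LHS]ffunE [RHS]ffunE weight_GL -fh.
- by rewrite [LHS]ffunE [RHS]ffunE weight_GL -fh.
Qed.

Lemma invariant_submod : submod_closed inv.
Proof.
split=> [|a f f' /GL_invariantP fi /GL_invariantP fi'].
  by apply/GL_invariantP => g x; rewrite !ffunE.
by apply/GL_invariantP => g x; rewrite !add_tfunE !scale_tfunE -fi -fi'.
Qed.

Section FiberValues.

Variable f : tfun R d D.
Hypothesis finv : f \in inv.
Variable x : tpv d D.

Lemma fval_UE w : in_range (rt x) (nt x) w ->
  fval (act UE f) x w = \sum_i coefUE R (rt x) (nt x) w i * fval f x (incr w i).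
Proof.
move=> w_in; have [y yf] := fiber_exists w_in.
rewrite (fval_eq (act_invariant UE finv) yf) (act_UE y finv).
have [-> ->] := fiber_rt_nt yf; case/fiberP: (yf) => _ _ ->.
by apply: eq_bigr => i _; rewrite (fval_fiber _ _ yf).
Qed.

Lemma fval_UF w : in_range (rt x) (nt x) w ->
  fval (act UF f) x w = \sum_i coefUF R (rt x) (nt x) w i * fval f x (decr w i).
Proof.
move=> w_in; have [y yf] := fiber_exists w_in.
rewrite (fval_eq (act_invariant UF finv) yf) (act_UF y finv).
have [-> ->] := fiber_rt_nt yf; case/fiberP: (yf) => _ _ ->.
by apply: eq_bigr => i _; rewrite (fval_fiber _ _ yf).
Qed.

Lemma fval_UK w : fval (act UK f) x w = q ^ wtsum (rt x) (nt x) w * fval f x w.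
Proof.
case: (boolP (in_range (rt x) (nt x) w)) => w_in; last first.
  by rewrite !fval_out // mulr0.
have [y yf] := fiber_exists w_in.
rewrite (fval_eq (act_invariant UK finv) yf) (fval_eq finv yf) ffunE weightE.
by have [-> ->] := fiber_rt_nt yf; case/fiberP: (yf) => _ _ ->.
Qed.

Lemma fval_UKi w : fval (act UKi f) x w = q ^ (- wtsum (rt x) (nt x) w) * fval f x w.
Proof.
case: (boolP (in_range (rt x) (nt x) w)) => w_in; last first.
  by rewrite !fval_out // mulr0.
have [y yf] := fiber_exists w_in.
rewrite (fval_eq (act_invariant UKi finv) yf) (fval_eq finv yf) ffunE weightE.
by have [-> ->] := fiber_rt_nt yf; case/fiberP: (yf) => _ _ ->.
Qed.

Lemma coefUE_out r n w i : (n i <= w i <= n i)%N -> coefUE R r n w i = 0.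
Proof. by rewrite -eqn_leq => /eqP e; rewrite /coefUE e subrr qint0 mulr0. Qed.

Lemma coefUF_out r n w i : (r i <= w i <= r i)%N -> coefUF R r n w i = 0.
Proof. by rewrite -eqn_leq => /eqP e; rewrite /coefUF e subrr qint0 mulr0. Qed.

(** The inner formula requires [incr (wt x) i] to be in range; when it is not, [wt x i = nt x i] and
    the outer coefficient is zero. *)
Lemma act_UEF : act UE (act UF f) x =
  \sum_i coefUE R (rt x) (nt x) (wt x) i *
    \sum_j coefUF R (rt x) (nt x) (incr (wt x) i) j *
      fval f x (decr (incr (wt x) i) j).
Proof.
rewrite (act_UE x (act_invariant _ finv)); apply: eq_bigr => i _.
case: (ltnP (wt x i) (nt x i)) => wn; last by rewrite coefUE_out ?mul0r ?wn ?wt_le_nt.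
suff w_in : in_range (rt x) (nt x) (incr (wt x) i) by rewrite (fval_UF w_in).
apply/in_rangeP => j; have := in_range_wt x => /in_rangeP/(_ j).
have [->|ji] := eqVneq j i; last by rewrite incr_ne.
by rewrite incr_at wn andbT => /andP[/leqW].
Qed.

Lemma act_UFE : act UF (act UE f) x =
  \sum_j coefUF R (rt x) (nt x) (wt x) j *
    \sum_i coefUE R (rt x) (nt x) (decr (wt x) j) i *
      fval f x (incr (decr (wt x) j) i).
Proof.
rewrite (act_UF x (act_invariant _ finv)); apply: eq_bigr => j _.
case: (ltnP (rt x j) (wt x j)) => wr; last by rewrite coefUF_out ?mul0r ?wr ?rt_le_wt.
suff w_in : in_range (rt x) (nt x) (decr (wt x) j) by rewrite (fval_UE w_in).
apply/in_rangeP => i; have := in_range_wt x => /in_rangeP/(_ i).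
have [->|ij] := eqVneq i j; last by rewrite decr_ne.
move=> /andP[_ wn]; rewrite decr_at; apply/andP; split; last exact: leq_trans (leq_pred _) wn.
by rewrite -ltnS prednK // (leq_ltn_trans _ wr).
Qed.

End FiberValues.

(** For [UE] and [UF] this is read off from the coefficient formulas, which invariance makes
    available. *)
Lemma act_linear g (a : Cq R) : {in inv &, forall f f',
  act g (a *: f + f') = a *: act g f + act g f'}.
Proof.
move=> f f' fi fi'; have [_ ic] := invariant_submod; have ffi := ic a f f' fi fi'.
apply/ffunP => x; rewrite add_tfunE scale_tfunE; case: g.
- by rewrite [LHS]ffunE [in RHS]ffunE [X in _ = _ + X]ffunE add_tfunE scale_tfunE.
- apply: etrans (act_UE x ffi) _.
  apply: etrans (congr2 (fun u v => a * u + v) (esym (act_UE x fi)) (esym (act_UE x fi'))).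
  apply: etrans (sum_coef_linear _ _ _ _); apply: eq_bigr => i _.
  by congr (_ * _); exact: fvalD.
- apply: etrans (act_UF x ffi) _.
  apply: etrans (congr2 (fun u v => a * u + v) (esym (act_UF x fi)) (esym (act_UF x fi'))).
  apply: etrans (sum_coef_linear _ _ _ _); apply: eq_bigr => i _.
  by congr (_ * _); exact: fvalD.
- rewrite [LHS]ffunE [in RHS]ffunE [X in _ = _ + X]ffunE add_tfunE scale_tfunE.
  by rewrite mulrDr mulrCA.
rewrite [LHS]ffunE [in RHS]ffunE [X in _ = _ + X]ffunE add_tfunE scale_tfunE.
by rewrite mulrDr mulrCA.
Qed.

Lemma wtsum_incr r n w i : wtsum r n (incr w i) = wtsum r n w - 2.
Proof. by rewrite /wtsum sum_incr; lia. Qed.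

Lemma wtsum_decr r n w i : (0 < w i)%N -> wtsum r n (decr w i) = wtsum r n w + 2.
Proof. by move=> /decrK e; rewrite -{2}e wtsum_incr subrK. Qed.

Lemma act_UK f x : act UK f x = q ^ weight x * f x.
Proof. by rewrite ffunE. Qed.

Lemma act_UKi f x : act UKi f x = q ^ (- weight x) * f x.
Proof. by rewrite ffunE. Qed.

Lemma act_UK_UE f x : f \in inv -> act UK (act UE f) x = q ^+ 2 * act UE (act UK f) x.
Proof.
move=> fi; apply: etrans (act_UK _ _) _.
apply: etrans (congr1 ( *%R _) (act_UE x fi)) _.
apply: etrans _ (congr1 ( *%R _) (esym (act_UE x (act_invariant UK fi)))).
apply: sum_coef_scale_neq0 => i _.
by rewrite (fval_UK fi) wtsum_incr weightE mulrA exprnP -qE addrC subrK.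
Qed.

Lemma act_UK_UF f x : f \in inv -> act UK (act UF f) x = q ^- 2 * act UF (act UK f) x.
Proof.
move=> fi; apply: etrans (act_UK _ _) _.
apply: etrans (congr1 ( *%R _) (act_UF x fi)) _.
apply: etrans _ (congr1 ( *%R _) (esym (act_UF x (act_invariant UK fi)))).
apply: sum_coef_scale_neq0 => i.
case: (ltnP (rt x i) (wt x i)) => wr; last first.
  by move=> /eqP[]; rewrite coefUF_out ?wr ?rt_le_wt.
move=> _; rewrite (fval_UK fi) wtsum_decr ?(leq_ltn_trans _ wr) //.
by rewrite weightE mulrA exprnN -qE addrC addrK.
Qed.

Lemma act_UE_UF f x : f \in inv ->
  act UE (act UF f) x - act UF (act UE f) x =
  (q - q^-1)^-1 * (act UK f x - act UKi f x).
Proof.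
move=> fi; apply: etrans (congr2 (fun u v => u - v) (act_UEF fi x) (act_UFE fi x)) _.
apply: etrans (EF_commutator (q_neq0 R) (q_sub_inv_neq0 R) _ (fval f x) (@rt_le_wt _ _ _ _ x)) _.
apply: etrans _ (congr2 (fun u v => _ * (u - v)) (esym (act_UK f x)) (esym (act_UKi f x))).
by rewrite weightE (fval_eq fi (fiber_refl x)).
Qed.

Lemma invariant_Uq_module : Uq_module inv act.
Proof.
split.
- exact: invariant_submod.
- by move=> g f; exact: act_invariant.
- by move=> g a; exact: act_linear.
- by move=> f _; apply/ffunP => x; rewrite ffunE.
- move=> f _; apply/ffunP => x; apply: etrans (act_UK _ _) _.
  apply: etrans (congr1 ( *%R _) (act_UKi _ _)) _.
  by rewrite mulrA -qE subrr expr0z mul1r.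
- move=> f _; apply/ffunP => x; apply: etrans (act_UKi _ _) _.
  apply: etrans (congr1 ( *%R _) (act_UK _ _)) _.
  by rewrite mulrA -qE addNr expr0z mul1r.
- move=> f fi; apply/ffunP => x; apply: etrans _ (esym (scale_tfunE _ _ _)).
  exact: act_UK_UE.
- move=> f fi; apply/ffunP => x; apply: etrans _ (esym (scale_tfunE _ _ _)).
  exact: act_UK_UF.
move=> f fi; apply/ffunP => x; apply: etrans (sub_tfunE _ _ _) _.
apply: etrans _ (esym (scale_tfunE _ _ _)).
apply: etrans _ (congr1 ( *%R _) (esym (sub_tfunE _ _ _))).
exact: act_UE_UF.
Qed.

End InvariantModule.

(** * The action on the tensor product in coordinates *)

Lemma iter_comul_U1 k : iter_comul k U1 = [:: nseq k U1].
Proof. by elim: k => //= k ->. Qed.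

Lemma iter_comul_UK k : iter_comul k UK = [:: nseq k UK].
Proof. by elim: k => //= k ->. Qed.

Lemma iter_comul_UKi k : iter_comul k UKi = [:: nseq k UKi].
Proof. by elim: k => //= k ->. Qed.

Lemma iter_comul_UE k : iter_comul k UE =
  [seq nseq i UK ++ UE :: nseq (k - i.+1) U1 | i <- iota 0 k].
Proof.
elim: k => //= k ->; rewrite iter_comul_U1 /= cats0 subn1 /=; congr (_ :: _).
by rewrite -[1%N]addn0 iotaDl -!map_comp; apply: eq_map.
Qed.

Lemma iter_comul_UF k : iter_comul k UF =
  [seq nseq i U1 ++ UF :: nseq (k - i.+1) UKi | i <- iota 0 k].
Proof.
elim: k => //= k ->; rewrite iter_comul_UKi /= cats0 subn1 /=; congr (_ :: _).
by rewrite -[1%N]addn0 iotaDl -!map_comp; apply: eq_map.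
Qed.

Lemma nth_insert (T : Type) (z a b c : T) k i j : (j < k)%N -> (i < k)%N ->
  nth z (nseq i a ++ b :: nseq (k - i.+1) c) j =
  if (j < i)%N then a else if j == i then b else c.
Proof.
move=> jk ik; rewrite nth_cat size_nseq nth_nseq; case: ltngtP => // [ij|->].
  by rewrite -(subnSK ij) /= nth_nseq ifT //; lia.
by rewrite subnn.
Qed.

Section Products.

Variables (K : fieldType) (x : K).
Hypothesis x0 : x != 0.
Variable (k : nat).
Implicit Types (a : 'I_k -> int) (i : 'I_k).

Lemma prod_expz (P : pred 'I_k) a :
  \prod_(j | P j) x ^ a j = x ^ (\sum_(j | P j) a j).
Proof. by rewrite (big_morph _ (fun m n => expfzDr m n x0) (expr0z x)). Qed.

(** The scalar produced by the summand of the comultiplication of [E] with [K] before the place [i],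
    [E] at [i] and 1 after it; [prod_after] is its analogue for [F]. *)
Lemma prod_before a b i :
  \prod_(j < k) (if (j < i)%N then x ^ a j else if j == i :> nat then b else 1) =
  x ^ (\sum_(j < k | (j < i)%N) a j) * b.
Proof.
rewrite -prod_expz (bigID (fun j : 'I_k => (j < i)%N)) /=; congr (_ * _).
  by apply: eq_bigr => j ->.
rewrite (bigD1 i) ?ltnn //= eqxx big1 ?mulr1 // => j /andP[/negbTE -> ji].
by rewrite (_ : (_ == _) = false) //; apply: negbTE.
Qed.

Lemma prod_after a b i :
  \prod_(j < k) (if (j < i)%N then 1 else if j == i :> nat then b else x ^ a j) =
  x ^ (\sum_(j < k | (i < j)%N) a j) * b.
Proof.
rewrite -prod_expz mulrC (bigD1 i) //= ltnn eqxx; congr (_ * _).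
rewrite (bigID (fun j : 'I_k => (i < j)%N)) /= mulrC big1 ?mul1r; last first.
  by move=> j /andP[ji]; rewrite -val_eqE /= in ji *; case: ltngtP ji.
apply: eq_big => [j|j]; first by rewrite -val_eqE /=; case: ltngtP.
by case/andP => _; case: ltngtP.
Qed.

Lemma prod_indicator (b : 'I_k -> bool) :
  \prod_j (b j)%:R = ([forall j, b j] : bool)%:R :> K.
Proof.
case: (boolP [forall j, b j]) => [/forallP h|].
  by rewrite big1 // => j _; rewrite h.
by rewrite negb_forall => /existsP[j /negbTE bj]; rewrite (bigD1 j) //= bj mul0r.
Qed.

End Products.

Section TensorAction.

Variables (R : realType).
Local Notation q := (@q R).
Local Notation qint := (@qint R).

Lemma vvecE e (m : int) (u : 'I_e.+1) :
  vvec R e m u = (m == e%:Z - (u : nat)%:Z *+ 2)%:R.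
Proof. by rewrite ffunE. Qed.

Section Basis.

Variables (e : nat) (p u : 'I_e.+1).
Let m : int := e%:Z - (p : nat)%:Z *+ 2.

Lemma vact_U1 : vact_basis R e U1 m u = (p == u)%:R.
Proof.
rewrite /vact_basis vvecE /m -val_eqE; congr (_%:R); congr nat_of_bool.
by apply/eqP/eqP => /=; lia.
Qed.

Lemma vact_UK : vact_basis R e UK m u = q ^ (e%:Z - (u : nat)%:Z *+ 2) * (p == u)%:R.
Proof.
rewrite -vact_U1 [LHS]ffunE /vact_basis vvecE.
by case: eqP => [->|_] //; rewrite [LHS]mulr0 mulr0.
Qed.

Lemma vact_UKi : vact_basis R e UKi m u =
  q ^ (- (e%:Z - (u : nat)%:Z *+ 2)) * (p == u)%:R.
Proof.
rewrite -vact_U1 [LHS]ffunE /vact_basis vvecE.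
by case: eqP => [->|_] //; rewrite [LHS]mulr0 mulr0.
Qed.

(** The coefficient is expressed by the target index: for [p = u + 1], [[(e + m) / 2 + 1]] is
    [[e - u]], the form found in [coefUE]. *)
Lemma vact_UE : vact_basis R e UE m u =
  qint (e%:Z - (u : nat)%:Z) * ((p : nat) == u + 1)%N%:R.
Proof.
rewrite [LHS]ffunE vvecE; have -> : (m + 2 == e%:Z - (u : nat)%:Z *+ 2) = ((p : nat) == u + 1)%N.
  by apply/eqP/eqP; rewrite /m; lia.
case: eqP => [pu|_]; last by rewrite [LHS]mulr0 mulr0.
congr (qint _ * _); rewrite (_ : e%:Z + m = (e%:Z - (p : nat)%:Z) * 2) ?mulzK //.
  by rewrite pu; lia.
by rewrite /m; lia.
Qed.

Lemma vact_UF : vact_basis R e UF m u =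
  qint (u : nat)%:Z * ((p + 1)%N == u :> nat)%:R.
Proof.
rewrite [LHS]ffunE vvecE; have -> : (m - 2 == e%:Z - (u : nat)%:Z *+ 2) = ((p + 1)%N == u :> nat).
  by apply/eqP/eqP; rewrite /m; lia.
case: eqP => [pu|_]; last by rewrite [LHS]mulr0 mulr0.
congr (qint _ * _); rewrite (_ : e%:Z - m = (p : nat)%:Z * 2) ?mulzK //; first by lia.
by rewrite /m; lia.
Qed.

End Basis.

End TensorAction.

(** For operators sending a basis vector to a multiple of at most one basis vector, the scalar
    depends on the target only and leaves the sum. *)
Lemma sum_prod_coef (K : fieldType) (T : finType) (k : nat) (v : T -> K)
    (c : 'I_k -> K) (b : T -> 'I_k -> bool) (G : T -> 'I_k -> K) :
  (forall p j, G p j = c j * (b p j)%:R) ->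
  \sum_p v p * \prod_j G p j =
  (\prod_j c j) * \sum_p v p * ([forall j, b p j] : bool)%:R.
Proof.
move=> GE; rewrite big_distrr; apply: eq_bigr => p _ /=.
rewrite (eq_bigr _ (fun j _ => GE p j)) big_split /= prod_indicator.
by rewrite mulrCA.
Qed.

Lemma sum_indicator (K : fieldType) (T : finType) (v : T -> K) (b : pred T) (p0 : T) :
  (forall p, b p = (p == p0)) -> \sum_p v p * (b p : bool)%:R = v p0.
Proof.
move=> bE; rewrite (bigD1 p0) //= bE eqxx mulr1 big1 ?addr0 // => p /negbTE pp.
by rewrite bE pp mulr0.
Qed.

Lemma sum_iota0 (V : nmodType) (G : nat -> V) k :
  \sum_(i <- iota 0 k) G i = \sum_(i < k) G i.
Proof. by rewrite -(big_mkord xpredT G) /index_iota subn0. Qed.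

Section TensorActionCoordinates.

Variables (R : realType) (k : nat) (e : 'I_k -> nat).
Local Notation q := (@q R).
Local Notation qint := (@qint R).
Local Notation Idx := {dffun forall i : 'I_k, 'I_(e i).+1}.

Variables (v : Vtens R e) (p0 : Idx).
Let m i : int := (e i)%:Z - (p0 i : nat)%:Z *+ 2.

Lemma tens_act_at g : tens_act g v p0 =
  \sum_(s <- iter_comul k g) \sum_(p : Idx)
    v p * \prod_i vact_basis R (e i) (nth U1 s i)
                    ((e i)%:Z - (p i : nat)%:Z *+ 2) (p0 i).
Proof.
rewrite /tens_act sum_ffunE; apply: eq_bigr => s _.
rewrite sum_ffunE; apply: eq_bigr => p _.
by rewrite ffunE; congr (_ * _); rewrite ffunE.
Qed.

Lemma sum_same : \sum_(p : Idx) v p * ([forall j, p j == p0 j] : bool)%:R = v p0.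
Proof.
apply: (@sum_indicator _ Idx v (fun p => [forall j, p j == p0 j])) => p.
apply/forallP/eqP => [h|-> //]; apply/ffunP => j; exact/eqP.
Qed.

Lemma tens_U1 : tens_act U1 v p0 = v p0.
Proof.
rewrite tens_act_at iter_comul_U1 big_seq1.
rewrite (@sum_prod_coef _ Idx k v (fun _ => 1) (fun (p : Idx) j => p j == p0 j)); last first.
  by move=> p j; rewrite nth_nseq ltn_ord vact_U1 mul1r.
by rewrite big1 // mul1r sum_same.
Qed.

Lemma tens_UK : tens_act UK v p0 = q ^ (\sum_i m i) * v p0.
Proof.
rewrite tens_act_at iter_comul_UK big_seq1.
rewrite (@sum_prod_coef _ Idx k v (fun j => q ^ m j) (fun (p : Idx) j => p j == p0 j)); last first.
  by move=> p j; rewrite nth_nseq ltn_ord vact_UK.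
by rewrite sum_same (prod_expz (q_neq0 R)).
Qed.

Lemma tens_UKi : tens_act UKi v p0 = q ^ (- \sum_i m i) * v p0.
Proof.
rewrite tens_act_at iter_comul_UKi big_seq1.
rewrite (@sum_prod_coef _ Idx k v (fun j => q ^ (- m j))
  (fun (p : Idx) j => p j == p0 j)); last first.
  by move=> p j; rewrite nth_nseq ltn_ord vact_UKi.
by rewrite sum_same (prod_expz (q_neq0 R)) sumrN.
Qed.

(** The indicator sum is the coordinate of [v] at [p0 + e_i], read as 0 when that index leaves the
    box. *)
Lemma tens_UE : tens_act UE v p0 =
  \sum_(i < k) q ^ (\sum_(j < k | (j < i)%N) m j) * qint ((e i)%:Z - (p0 i : nat)%:Z) *
    \sum_(p : Idx) v p * ([forall j, p j == p0 j + (j == i) :> nat]%N : bool)%:R.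
Proof.
rewrite tens_act_at iter_comul_UE big_map sum_iota0.
apply: eq_bigr => i _; rewrite -(prod_before (q_neq0 R)).
apply: sum_prod_coef => p j; rewrite nth_insert // -val_eqE.
case: (ltngtP j i) => /= [ji|ij|ji].
- by rewrite vact_UK addn0.
- by rewrite vact_U1 addn0 mul1r.
by rewrite vact_UE; have -> : j = i by apply: val_inj.
Qed.

Lemma tens_UF : tens_act UF v p0 =
  \sum_(i < k) q ^ (\sum_(j < k | (i < j)%N) - m j) * qint (p0 i : nat)%:Z *
    \sum_(p : Idx) v p * ([forall j, (p j + (j == i))%N == p0 j :> nat] : bool)%:R.
Proof.
rewrite tens_act_at iter_comul_UF big_map sum_iota0.
apply: eq_bigr => i _; rewrite -(prod_after (q_neq0 R)).
apply: sum_prod_coef => p j; rewrite nth_insert // -val_eqE.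
case: (ltngtP j i) => /= [ji|ij|ji].
- by rewrite vact_U1 addn0 mul1r.
- by rewrite vact_UKi addn0.
by rewrite vact_UF; have -> : j = i by apply: val_inj.
Qed.

End TensorActionCoordinates.

(** * The span of the basic functions *)

Lemma sum_delta (V : nmodType) (I : finType) (P : pred I) (G : I -> V) i :
  \sum_(j | P j) G j *+ (j == i) = if P i then G i else 0.
Proof.
rewrite big_mkcond (bigD1 i) //= eqxx mulr1n big1 ?addr0 // => j /negbTE ->.
by case: ifP.
Qed.

Lemma Posz_sum (I : finType) (P : pred I) (G : I -> nat) :
  (\sum_(i | P i) G i)%N%:Z = \sum_(i | P i) (G i)%:Z.
Proof. exact: (big_morph Posz PoszD (erefl _)). Qed.

(** Only products over pairs [a < b] occur, so raising one entry changes the exponent by an affine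
    form: [r_a - w_a] for each [a] before [i] and [n_b - w_b] for each [b] after [i]. *)
Lemma basic_exp_incr k (w r n : {ffun 'I_k -> nat}) i :
  basic_exp (incr w i) r n = basic_exp w r n +
  ((psum r i)%:Z - (psum w i)%:Z + ((gsum n i)%:Z - (gsum w i)%:Z)).
Proof.
have E (a b : 'I_k) : (a < b)%N ->
    (r a * incr w i b)%N%:Z + (incr w i a * n b)%N%:Z - (incr w i a * incr w i b)%N%:Z =
    (r a * w b)%N%:Z + (w a * n b)%N%:Z - (w a * w b)%N%:Z +
    (((r a)%:Z - (w a)%:Z) *+ (b == i) + ((n b)%:Z - (w b)%:Z) *+ (a == i)).
  move=> ab; rewrite !ffunE.
  have [ai|_] := eqVneq a i; have [bi|_] := eqVneq b i; rewrite /= ?addn0 ?addn1 ?mulr0n ?mulr1n.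
  - by rewrite ai bi ltnn in ab.
  - by rewrite !mulSn; lia.
  - by rewrite !mulnS; lia.
  by lia.
rewrite /basic_exp (eq_bigr _ (fun a _ => eq_bigr _ (E a))).
rewrite (eq_bigr _ (fun a _ => big_split _ _ _ _ _)) big_split /=; congr (_ + _).
rewrite (eq_bigr _ (fun a _ => big_split _ _ _ _ _)) big_split /=; congr (_ + _).
  rewrite (eq_bigr _ (fun a _ => sum_delta _ _ _)) -big_mkcond /= sumrB.
  by rewrite !Posz_sum.
rewrite (eq_bigr _ (fun a _ => sumrMnl _ _ _ _)) /= sum_delta sumrB.
by rewrite !Posz_sum.
Qed.

Lemma mul_expz_regroup (K : fieldType) (x Q G : K) (a b c d : int) :
  x != 0 -> a + b = c + d -> x ^ a * (x ^ b * Q * G) = x ^ c * Q * (x ^ d * G).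
Proof.
move=> x0 abcd; rewrite -[x ^ b * _ * _]mulrA mulrA -expfzDr // abcd expfzDr //.
by rewrite mulrACA mulrA.
Qed.

Section BasicSpan.

Variables (R : realType) (F : finFieldType) (k : nat) (d : {ffun 'I_k -> nat}).
Variable D : vectType F.
Hypothesis hD : \dim (fullv : {vspace D}) = (\sum_i d i)%N.
Implicit Types x y : tpv d D.
Implicit Types f : tfun R d D.
Implicit Types (w u : {ffun 'I_k -> nat}) (i j : 'I_k).
Local Notation q := (@q R).
Local Notation inv := (@GL_invariant R F k d D).
Local Notation act := (@tpv_act R F k d D).

Variables r n : {ffun 'I_k -> nat}.
Local Notation span := (@basic_span R F k d D r n).

Definition typed x : bool := (rt x == r) && (nt x == n).

Lemma basicE w x : basic R d D w r n x = q ^ basic_exp w r n * ((wt x == w) && typed x)%:R.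
Proof. by rewrite ffunE inE. Qed.

(** Linear combinations become arbitrary functions of [wt] on the points of type [(r, n)], and no
    linear independence has to be discussed. *)
Lemma basic_spanP f : f \in span <->
  exists c : {ffun 'I_k -> nat} -> Cq R, forall x, f x = c (wt x) *+ typed x.
Proof.
rewrite unfold_in; split=> [/asboolP[s [c ->]]|[c fc]].
  exists (fun u => \sum_(w <- s) c w * (q ^ basic_exp w r n * (u == w)%:R)) => x.
  rewrite sum_ffunE -sumrMnl; apply: eq_bigr => w _.
  apply: etrans (scale_tfunE _ _ _) _; rewrite basicE.
  by case: (typed x); rewrite ?andbT ?andbF ?mulr1n ?mulr0n // !mulr0.
apply/asboolP; exists (undup [seq wt x | x : tpv d D]).
exists (fun w => c w * q ^ (- basic_exp w r n)); apply/ffunP => x; rewrite sum_ffunE fc.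
have xs : wt x \in undup [seq wt x | x : tpv d D] by rewrite mem_undup image_f.
apply: etrans _ (esym (bigD1_seq (wt x) xs (undup_uniq _))) => /=.
rewrite big1 => [|w ww]; last first.
  apply: etrans (scale_tfunE _ _ _) _; rewrite basicE eq_sym (negbTE ww).
  by rewrite !mulr0.
rewrite addr0; apply: etrans _ (esym (scale_tfunE _ _ _)).
rewrite basicE eqxx /= -mulrA [q ^ _ * (_ * _)]mulrA -qE addNr expr0z mul1r.
by rewrite mulr_natr.
Qed.

Lemma typed_fiber x w y : y \in fiber x w -> typed y = typed x.
Proof. by case/fiber_rt_nt => e1 e2; rewrite /typed e1 e2. Qed.

Lemma span_invariant : {subset span <= inv}.
Proof.
move=> f /basic_spanP[c fc]; apply/GL_invariantP => g x.
by rewrite !fc /typed wt_GL rt_GL nt_GL.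
Qed.

Lemma fval_span f (c : {ffun 'I_k -> nat} -> Cq R) x w :
  (forall x, f x = c (wt x) *+ typed x) ->
  fval f x w = c w *+ in_range r n w *+ typed x.
Proof.
move=> fc; have fi : f \in inv by apply: span_invariant; apply/basic_spanP; exists c.
case: (boolP (in_range (rt x) (nt x) w)) => w_in; last first.
  rewrite fval_out //; case: (boolP (typed x)) => // /andP[/eqP er /eqP en].
  by rewrite -er -en (negbTE w_in).
have [y yf] := fiber_exists w_in; rewrite (fval_eq fi yf) fc (typed_fiber yf).
case/fiberP: yf => _ _ ->; case: (boolP (typed x)) => // /andP[/eqP er /eqP en].
by rewrite -er -en w_in.
Qed.

Lemma span_submod : submod_closed span.
Proof.
split=> [|a f f' /basic_spanP[c fc] /basic_spanP[c' fc']].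
  by apply/basic_spanP; exists (fun _ => 0) => x; rewrite ffunE mul0rn.
apply/basic_spanP; exists (fun w => a * c w + c' w) => x.
by rewrite add_tfunE scale_tfunE fc fc' mulrnDl mulrnAr.
Qed.

Lemma span_act g f : f \in span -> act g f \in span.
Proof.
move=> fs; have fi := span_invariant fs; case/basic_spanP: fs => c fc.
have typedE x : typed x -> rt x = r /\ nt x = n by case/andP=> /eqP ? /eqP ?.
case: g; apply/basic_spanP.
- by exists c => x; rewrite ffunE.
(* The function [c] is unconstrained out of range, where [fval] is 0; hence the indicator. *)
- exists (fun w => \sum_i coefUE R r n w i * (c (incr w i) *+ in_range r n (incr w i))) => x.
  apply: etrans (act_UE x fi) _; rewrite -sumrMnl; apply: eq_bigr => i _.
  rewrite (fval_span x _ fc) -mulrnAr.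
  by case: (boolP (typed x)) => [/typedE[-> ->]//|_]; rewrite !mulr0n !mulr0.
- exists (fun w => \sum_i coefUF R r n w i * (c (decr w i) *+ in_range r n (decr w i))) => x.
  apply: etrans (act_UF x fi) _; rewrite -sumrMnl; apply: eq_bigr => i _.
  rewrite (fval_span x _ fc) -mulrnAr.
  by case: (boolP (typed x)) => [/typedE[-> ->]//|_]; rewrite !mulr0n !mulr0.
- exists (fun w => q ^ wtsum r n w * c w) => x; apply: etrans (act_UK _ _) _.
  rewrite fc weightE // -mulrnAr.
  by case: (boolP (typed x)) => [/typedE[-> ->]//|_]; rewrite !mulr0n !mulr0.
exists (fun w => q ^ (- wtsum r n w) * c w) => x; apply: etrans (act_UKi _ _) _.
rewrite fc weightE // -mulrnAr.
by case: (boolP (typed x)) => [/typedE[-> ->]//|_]; rewrite !mulr0n !mulr0.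
Qed.

Lemma span_Uq_module : Uq_module span act.
Proof.
have [_ _ l a1 a2 a3 a4 a5 a6] := invariant_Uq_module R hD.
have sub := span_invariant.
split.
- exact: span_submod.
- by move=> g f; exact: span_act.
- by move=> g a f f' /sub fi /sub fi'; exact: l.
- by move=> f /sub; exact: a1.
- by move=> f /sub; exact: a2.
- by move=> f /sub; exact: a3.
- by move=> f /sub; exact: a4.
- by move=> f /sub; exact: a5.
by move=> f /sub; exact: a6.
Qed.

End BasicSpan.

(** * The isomorphism *)

Section Eta.

Variables (R : realType) (F : finFieldType) (k : nat) (d : {ffun 'I_k -> nat}).
Variable D : vectType F.
Hypothesis hD : \dim (fullv : {vspace D}) = (\sum_i d i)%N.
Implicit Types x y : tpv d D.
Implicit Types f : tfun R d D.
Implicit Types (w u : {ffun 'I_k -> nat}) (i j : 'I_k).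
Local Notation q := (@q R).
Local Notation qint := (@qint R).
Local Notation inv := (@GL_invariant R F k d D).
Local Notation act := (@tpv_act R F k d D).

Variables (x0 : tpv d D) (r n : {ffun 'I_k -> nat}).
Hypotheses (x0r : rt x0 = r) (x0n : nt x0 = n).
Local Notation span := (@basic_span R F k d D r n).
Local Notation e := (fun i : 'I_k => (n i - r i)%N).
Local Notation Idx := {dffun forall i : 'I_k, 'I_(e i).+1}.
Implicit Types p : Idx.

Lemma leq_rn i : (r i <= n i)%N.
Proof. by rewrite -x0r -x0n (leq_trans (rt_le_wt x0 i)) ?wt_le_nt. Qed.

Definition shift p : {ffun 'I_k -> nat} := [ffun i => (r i + p i)%N].
Definition unshift u : Idx := [ffun i => inord (u i - r i)].

Lemma shift_range p : in_range r n (shift p).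
Proof.
apply/in_rangeP => i; rewrite ffunE leq_addr /=.
by have := ltn_ord (p i); have := leq_rn i; rewrite ltnS; lia.
Qed.

Lemma unshiftK u : in_range r n u -> shift (unshift u) = u.
Proof.
move/in_rangeP => u_in; apply/ffunP => i; rewrite !ffunE.
by case/andP: (u_in i) => ru un; rewrite inordK ?subnKC // ltnS leq_sub2r.
Qed.

Lemma shift_inj : injective shift.
Proof.
move=> p p' /ffunP pp; apply/ffunP => i; have := pp i; rewrite !ffunE => /addnI.
exact: val_inj.
Qed.

(** For [u] in range and [f] in the span, the coefficient of [f] on [basic u r n]. *)
Definition nval f u : Cq R := q ^ (- basic_exp u r n) * fval f x0 u.

Definition eta f : Vtens R e := [ffun p : Idx => nval f (shift p)].

Lemma etaE f p : eta f p = nval f (shift p).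
Proof. by rewrite ffunE. Qed.

Lemma nval_out f u : ~~ in_range r n u -> nval f u = 0.
Proof. by move=> u_out; rewrite /nval fval_out ?mulr0 // x0r x0n. Qed.

(** Out of range both sides are 0: the fiber is empty, and no [shift p] equals [u]. *)
Lemma sum_eta f u (b : pred Idx) : (forall p, b p = (shift p == u)) ->
  \sum_(p : Idx) eta f p * (b p : bool)%:R = nval f u.
Proof.
move=> bE; case: (boolP (in_range r n u)) => u_in.
  rewrite (@sum_indicator _ Idx (eta f) b (unshift u)) ?etaE ?unshiftK // => p.
  by rewrite bE -(inj_eq shift_inj) unshiftK.
rewrite nval_out // big1 // => p _; rewrite bE; case: eqP => [pu|_]; last exact: mulr0.
by case/negP: u_in; rewrite -pu shift_range.
Qed.

Lemma sum_weights (P : pred 'I_k) p :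
  \sum_(j | P j) ((e j)%:Z - (p j : nat)%:Z *+ 2) =
  (\sum_(j | P j) n j)%N%:Z + (\sum_(j | P j) r j)%N%:Z -
  (\sum_(j | P j) shift p j)%N%:Z *+ 2.
Proof.
rewrite !Posz_sum -sumrMnl -big_split -sumrB; apply: eq_bigr => j _ /=.
by rewrite ffunE; have := leq_rn j; lia.
Qed.

Lemma sum_weights_lt p (i : 'I_k) :
  \sum_(j < k | (j < i)%N) ((e j)%:Z - (p j : nat)%:Z *+ 2) =
  (psum n i)%:Z + (psum r i)%:Z - (psum (shift p) i)%:Z *+ 2.
Proof. exact: sum_weights. Qed.

Lemma sum_weights_gt p (i : 'I_k) :
  \sum_(j < k | (i < j)%N) ((e j)%:Z - (p j : nat)%:Z *+ 2) =
  (gsum n i)%:Z + (gsum r i)%:Z - (gsum (shift p) i)%:Z *+ 2.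
Proof. exact: sum_weights. Qed.

Lemma eta_UE f : f \in inv -> eta (act UE f) = tens_act UE (eta f).
Proof.
move=> fi; apply/ffunP => p; rewrite etaE tens_UE /nval.
apply: etrans (congr1 ( *%R _) (fval_UE hD fi _)) _; first by rewrite x0r x0n shift_range.
rewrite mulr_sumr; apply: eq_bigr => i _.
rewrite (@sum_eta f (incr (shift p) i)); last first.
  move=> p'; apply/forallP/eqP => [h|h j].
    by apply/ffunP => j; rewrite !ffunE (eqP (h j)) addnA.
  by move/ffunP: h => /(_ j); rewrite !ffunE -addnA => /addnI ->.
rewrite x0r x0n /coefUE /nval sum_weights_lt.
have -> : (n i)%:Z - (shift p i)%:Z = (e i)%:Z - (p i : nat)%:Z.
  by rewrite ffunE /=; have := leq_rn i; lia.
(* The increment of the normalization turns the exponent of [coefUE] into the total weight of the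
   factors before [i]. *)
apply: mul_expz_regroup (q_neq0 R) _; rewrite basic_exp_incr; lia.
Qed.

Lemma eta_UF f : f \in inv -> eta (act UF f) = tens_act UF (eta f).
Proof.
move=> fi; apply/ffunP => p; rewrite etaE tens_UF /nval.
apply: etrans (congr1 ( *%R _) (fval_UF hD fi _)) _; first by rewrite x0r x0n shift_range.
rewrite mulr_sumr; apply: eq_bigr => i _.
have piE : (shift p i)%:Z - (r i)%:Z = (p i : nat)%:Z.
  by rewrite ffunE PoszD addrC addrA addNr add0r.
(* For [p i = 0] both sides carry [qint 0]; otherwise [decr] stays in range and is undone by
   [incr]. *)
rewrite x0r x0n /coefUF piE; have [pi0|pi0] := posnP (p i).
  by rewrite pi0 qint0 !(mulr0, mul0r).
have spi : (0 < shift p i)%N by rewrite ffunE addn_gt0 pi0 orbT.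
rewrite (@sum_eta f (decr (shift p) i)); last first.
  move=> p'; apply/forallP/eqP => [h|h j].
    apply/ffunP => j; rewrite !ffunE -(eqP (h j)); lia.
  move/ffunP: h => /(_ j); rewrite !ffunE => h; apply/eqP; move: h.
  by case: (eqVneq j i) pi0 => [->|_] /=; lia.
rewrite /nval sumrN sum_weights_gt; apply: mul_expz_regroup (q_neq0 R) _.
have := basic_exp_incr (decr (shift p) i) r n i.
have := psum_incr (decr (shift p) i) i i; have := gsum_incr (decr (shift p) i) i i.
rewrite decrK // ltnn; lia.
Qed.

Lemma eta_act g f : f \in inv -> eta (act g f) = tens_act g (eta f).
Proof.
move=> fi; case: g; [|exact: eta_UE|exact: eta_UF| |]; apply/ffunP => p; rewrite etaE.
- by rewrite tens_U1 etaE; congr (_ * _); rewrite /fval; case: pickP => // y _; rewrite ffunE.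
- rewrite tens_UK etaE /nval; apply: etrans (congr1 ( *%R _) (fval_UK hD fi _ _)) _.
  by rewrite mulrCA sum_weights x0r x0n.
rewrite tens_UKi etaE /nval; apply: etrans (congr1 ( *%R _) (fval_UKi hD fi _ _)) _.
by rewrite mulrCA sum_weights x0r x0n.
Qed.

Lemma eta_linear (a : Cq R) f f' : eta (a *: f + f') = a *: eta f + eta f'.
Proof.
apply/ffunP => p; rewrite [LHS]ffunE [RHS]ffunE [X in _ = X + _]ffunE !etaE.
by rewrite /nval fvalD mulrDr mulrCA.
Qed.

Lemma typed_x0 : typed r n x0.
Proof. by rewrite /typed x0r x0n !eqxx. Qed.

(** A function in the span depends only on [wt] among points of type [(r, n)], so the fiber of [x0]
    determines it everywhere. *)
Lemma span_eval f x : f \in span ->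
  f x = (q ^ basic_exp (wt x) r n * eta f (unshift (wt x))) *+ typed r n x.
Proof.
case/basic_spanP => c fc; rewrite fc; case: (boolP (typed r n x)) => // /andP[/eqP xr /eqP xn].
have w_in : in_range r n (wt x) by rewrite -xr -xn in_range_wt.
rewrite etaE unshiftK // /nval mulrA -qE subrr expr0z mul1r.
by rewrite (fval_span _ _ fc) w_in typed_x0.
Qed.

Lemma eta_inj : {in span &, injective eta}.
Proof.
move=> f f' fs fs' ff; apply/ffunP => x.
by rewrite (span_eval x fs) (span_eval x fs') ff.
Qed.

Lemma eta_surj v : exists2 f, f \in span & eta f = v.
Proof.
pose c u : Cq R := q ^ basic_exp u r n * v (unshift u).
pose f : tfun R d D := [ffun x => c (wt x) *+ typed r n x].
have fc x : f x = c (wt x) *+ typed r n x by rewrite ffunE.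
exists f; first by apply/basic_spanP; exists c.
apply/ffunP => p; rewrite etaE /nval (fval_span _ _ fc) shift_range typed_x0 !mulr1n.
rewrite /c mulrA -qE addNr expr0z mul1r.
by congr (v _); apply: shift_inj; rewrite unshiftK // shift_range.
Qed.

(** This covers every [w]: out of range no [shift p] equals [w], and since [w - r] is taken in the
    integers, a negative entry gives the zero vector. *)
Lemma eta_basic w :
  eta (basic R d D w r n) = tens_vec R e (fun i => (w i)%:Z - (r i)%:Z).
Proof.
apply/ffunP => p; rewrite etaE [RHS]ffunE.
rewrite (eq_bigr (fun j => (w j == shift p j)%:R)); last first.
  move=> j _; rewrite vvecE; congr (_%:R); congr nat_of_bool.
  by rewrite ffunE; apply/eqP/eqP; lia.
rewrite prod_indicator /nval.
have -> : fval (basic R d D w r n) x0 (shift p) =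
    q ^ basic_exp w r n * (shift p == w)%:R.
  rewrite (@fval_span R F k d D r n _ (fun u => q ^ basic_exp w r n * (u == w)%:R)).
    by rewrite shift_range typed_x0 !mulr1n.
  move=> x; rewrite basicE; case: (typed r n x); rewrite ?andbT ?andbF //.
  by rewrite mulr0.
have -> : [forall j, w j == shift p j] = (shift p == w).
  by apply/forallP/eqP => [h|-> //]; apply/ffunP => j; rewrite (eqP (h j)).
by case: eqP => [->|_]; rewrite ?mulr0 // mulr1 -qE addNr expr0z.
Qed.

Lemma eta_Uq_iso : Uq_iso span act (@tens_act R k e) eta.
Proof.
split.
- by move=> a f f' _ _; exact: eta_linear.
- exact: eta_inj.
- exact: eta_surj.
by move=> g f /span_invariant; exact: eta_act.
Qed.

End Eta.

Theorem theorem2p2p1 (R : realType) (F : finFieldType) (k : nat)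
    (d : {ffun 'I_k -> nat}) (D : vectType F)
    (hD : \dim (fullv : {vspace D}) = (\sum_i d i)%N) :
  Uq_module (@GL_invariant R F k d D) (@tpv_act R F k d D) /\
  forall r n : {ffun 'I_k -> nat},
    (exists w : {ffun 'I_k -> nat}, @Aset F k d D w r n != set0) ->
    [/\ {subset @basic_span R F k d D r n <= @GL_invariant R F k d D},
        Uq_module (@basic_span R F k d D r n) (@tpv_act R F k d D)
      & exists eta : tfun R d D -> Vtens R (fun i => (n i - r i)%N),
          (forall w : {ffun 'I_k -> nat},
             eta (basic R d D w r n) =
             tens_vec R (fun i => (n i - r i)%N)
                        (fun i => (w i)%:Z - (r i)%:Z)) /\
          Uq_iso (@basic_span R F k d D r n) (@tpv_act R F k d D)
                 (@tens_act R k (fun i => (n i - r i)%N)) eta].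
Proof.
(* A point of a nonempty [Aset] is the base point. Without one all [basic w r n] would be 0, while
   the tensor product is not. *)
split=> [|r n [w /set0Pn[x0]]]; first exact: invariant_Uq_module.
rewrite inE => /and3P[_ /eqP x0r /eqP x0n].
have {}x0r : rt x0 = r := x0r; have {}x0n : nt x0 = n := x0n; split.
- exact: span_invariant.
- exact: span_Uq_module.
exists (@eta R F k d D x0 r n); split.
- by move=> u; exact: (eta_basic R hD x0r x0n).
- exact: (eta_Uq_iso R hD x0r x0n).
Qed.
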